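(* Let $m\ge 7$ and let $R_m=R(G_1,\dots,G_m)$ be a ring all of whose hinges are edges. Let $R'_m$ be obtained from $R_m$ by performing, for each link $G_i$, a Henneberg-II extension whose base vertex set is the set of hinge vertices $\{a_i,b_i,c_i,d_i\}$ of $G_i$ and which deletes a hinge edge of $G_i$. If $R_m$ is independent, each $G_i$ is rigid, and for each $i$ the graph obtained from $G_i$ by deleting its hinge edges is nucleation-free, then $R'_m$ is independent and nucleation-free, and each of its hinges is implied.
   Context: All graphs are finite and simple. Rank, independence, rigidity and circuits refer to the 3-dimensional generic rigidity matroid $\mathcal{R}_3$; $\mathrm{rank}(G)$ is the rank of $E(G)$. $G$ is independent if $\mathrm{rank}(G)=|E(G)|$; rigid if $\mathrm{rank}(G)$ equals the rank of the complete graph on $V(G)$ ($=3|V(G)|-6$ when $|V(G)|\ge 3$). A nonedge $f$ of $G$ is implied if $G\cup f$ contains a circuit containing $f$. A nucleation is a rigid subgraph on at least $5$ vertices; nucleation-free means having none. Ring: given $m\ge 3$ vertex-disjoint graphs $G_1,\dots,G_m$ (links), each with four distinct hinge vertices $a_i,b_i,c_i,d_i$, the ring $R(G_1,\dots,G_m)$ is obtained by identifying $a_1$ with $c_m$, $b_1$ with $d_m$, and, for $1\le i\le m-1$, $c_i$ with $a_{i+1}$ and $d_i$ with $b_{i+1}$. The pairs $(a_i,b_i)$ and $(c_i,d_i)$ are the hinges (of $G_i$ and of the ring). Henneberg-II extension: choose four existing vertices $W$ (the base vertex set) inducing at least one edge, delete one such edge, and add a new vertex adjacent to all vertices of $W$.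 *)

(* Defs.v *)
From HB Require Import structures.
From mathcomp Require Import all_boot all_order all_algebra.
From mathcomp Require Import boolp reals.
From mathcomp Require Import mpoly.

Set Implicit Arguments.
Unset Strict Implicit.
Unset Printing Implicit Defensive.

Import GRing.Theory.

Local Open Scope ring_scope.

(* Vertices are taken from a finite universe U, and an edge is the
   two-element set of its endpoints. *)
Section Graphs.
Variable U : finType.

Definition pairs (V : {set U}) : {set {set U}} :=
  [set e : {set U} | (e \subset V) && (#|e| == 2)].

Record sgraph := SGraph {
  verts : {set U};
  edges : {set {set U}};
  edges_pairs : edges \subset pairs verts
}.

Definition subgraph (H G : sgraph) : Prop :=
  verts H \subset verts G /\ edges H \subset edges G.

Fact del_edges_subproof (G : sgraph) (F : {set {set U}}) :
  edges G :\: F \subset pairs (verts G).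
Proof. exact: subset_trans (subsetDl _ _) (edges_pairs G). Qed.

Definition del_edges (G : sgraph) (F : {set {set U}}) : sgraph :=
  SGraph (del_edges_subproof G F).

Fact union_graph_subproof (I : finType) (G : I -> sgraph) :
  \bigcup_i edges (G i) \subset pairs (\bigcup_i verts (G i)).
Proof.
apply/bigcupsP=> i _; apply/subsetP=> e /(subsetP (edges_pairs _)).
rewrite !inE => /andP[sub ->]; rewrite andbT.
exact: subset_trans sub (bigcup_sup i _).
Qed.

Definition union_graph (I : finType) (G : I -> sgraph) : sgraph :=
  SGraph (union_graph_subproof G).

(* Identification of vertices along phi: vertices with the same image are
   merged.  Merged parallel edges become one edge and loops are dropped. *)
Fact identify_subproof (phi : U -> U) (G : sgraph) :
  [set phi @: (e : {set U}) | e in edges G] :&: pairs (phi @: verts G)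
    \subset pairs (phi @: verts G).
Proof. exact: subsetIr. Qed.

Definition identify (phi : U -> U) (G : sgraph) : sgraph :=
  SGraph (identify_subproof phi G).

Definition hennebergII (G : sgraph) (W e : {set U}) (v : U) (G' : sgraph)
    : Prop :=
  [/\ [/\ W \subset verts G & #|W| = 4%N],
      [/\ e \in edges G & e \subset W],
      v \notin verts G,
      verts G' = v |: verts G
    & edges G' = (edges G :\ e) :|: [set [set v; w] | w in W]].

End Graphs.

(* The three-dimensional generic rigidity matroid. *)
Section Rigidity.
Variables (R : realType) (U : finType).

(* The row of the edge {u, w} is p u - p w in the columns of u, p w - p u in
   those of w, and zero elsewhere: the sum below has a single nonzero term,
   for x the endpoint other than w. *)
Definition rigidity_matrix (p : U -> 'rV[R]_3) (E : {set {set U}})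
    : 'M[R]_(#|E|, #|U| * 3) :=
  \matrix_(i < #|E|)
    mxvec (\matrix_(j < #|U|, k < 3)
      let e := enum_val i in let w := enum_val j in
      if w \in e then \sum_(x in e) (p w 0 k - p x 0 k) else 0).

(* The coordinates of all the points are algebraically independent over
   the rationals. *)
Definition generic (p : U -> 'rV[R]_3) : Prop :=
  forall q : {mpoly rat[#|U| * 3]}, q != 0 ->
    mmap (ratr : rat -> R)
      (fun i => mxvec (\matrix_(j < #|U|, k < 3) p (enum_val j) 0 k) 0 i) q
    != 0.

(* All generic placements give the same independent sets. *)
Definition R3_indep (E : {set {set U}}) : Prop :=
  exists2 p : U -> 'rV[R]_3, generic p & row_free (rigidity_matrix p E).

Definition R3_rank (E : {set {set U}}) : nat :=
  \max_(F : {set {set U}} | (F \subset E) && `[< R3_indep F >]) #|F|.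

Definition R3_circuit (C : {set {set U}}) : Prop :=
  ~ R3_indep C /\ forall F : {set {set U}}, F \proper C -> R3_indep F.

Definition independent (G : sgraph U) : Prop :=
  R3_rank (edges G) = #|edges G|.

Definition rigid (G : sgraph U) : Prop :=
  R3_rank (edges G) = R3_rank (pairs (verts G)).

Definition implied (G : sgraph U) (f : {set U}) : Prop :=
  f \in pairs (verts G) :\: edges G /\
  exists C : {set {set U}},
    [/\ C \subset f |: edges G, f \in C & R3_circuit C].

Definition nucleation (G H : sgraph U) : Prop :=
  [/\ subgraph H G, rigid H & (5 <= #|verts H|)%N].

Definition nucleation_free (G : sgraph U) : Prop :=
  forall H : sgraph U, ~ nucleation G H.

End Rigidity.

Section Rings.
Variable U : finType.

Record link := Link {
  link_graph :> sgraph U;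
  ha : U; hb : U; hc : U; hd : U;
  hinge_uniq : uniq [:: ha; hb; hc; hd];
  hinge_verts : [set ha; hb; hc; hd] \subset verts link_graph
}.

Definition hinge_vertices (L : link) : {set U} :=
  [set ha L; hb L; hc L; hd L].

Definition hinges (L : link) : {set {set U}} :=
  [set [set ha L; hb L]; [set hc L; hd L]].

Section Ring.
Variables (m : nat) (G : 'I_m -> link).

Definition vertex_disjoint : Prop :=
  forall i j : 'I_m, i != j -> [disjoint verts (G i) & verts (G j)].

(* ordS is the cyclic successor, so the last link is glued to the first. *)
Definition glue (x : U) : U :=
  if [pick i | x == hc (G i)] is Some i then ha (G (ordS i))
  else if [pick i | x == hd (G i)] is Some i then hb (G (ordS i))
  else x.

Definition ring_graph : sgraph U :=
  identify glue (union_graph (fun i : 'I_m => G i : sgraph U)).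

Definition ring_hinge_vertices (i : 'I_m) : {set U} :=
  glue @: hinge_vertices (G i).

Definition ring_hinges (i : 'I_m) : {set {set U}} :=
  [set glue @: (h : {set U}) | h in hinges (G i)].

(* The extensions are performed one after the other, so each deleted hinge
   must still be an edge at that stage; the resulting graphs do not depend
   on the order in which the links are treated. *)
Definition henneberg_ring (R' : sgraph U) : Prop :=
  exists H : nat -> sgraph U,
    [/\ H 0%N = ring_graph,
        H m = R'
      & forall i : 'I_m, exists (e : {set U}) (v : U),
          e \in ring_hinges i /\
          hennebergII (H i) (ring_hinge_vertices i) e v (H i.+1)].

End Ring.
End Rings.

(* Main.v *)
From HB Require Import structures.
Require Import Defs.
From mathcomp Require Import all_boot all_order all_algebra.
From mathcomp Require Import boolp reals mpoly ring lra zify.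

(** Fix a generic placement p; the rank of an edge set is then the dimension of
  the span of its rows of the rigidity matrix at p, and an edge set that is
  independent at some placement is independent at p, since a nonzero minor is a
  polynomial with rational coefficients in the coordinates.

  R' is independent because a Henneberg-II extension deleting ab remains
  independent when the new vertex is put at the midpoint of ab.  All hinges are
  deleted, so the edges of R' are those of the links without hinges together
  with the stars of the new vertices.  Submodularity, applied link by link,
  bounds the rank of R' plus all hinges by m + sum_i (rank K(V_i) + 3 - 2), and
  |E(R')| is at least that since the links are rigid: the hinges are implied.

  Let H be a rigid subgraph of R' on a vertex set X of size at least 5, let x_i
  be the number of vertices of X in the i-th extended link and s_j the number of
  those on the j-th hinge.  If every s_j is positive, the number e_i of edges of
  H in the i-th link satisfies 2 e_i + 2 + 3 (s_i + s_(i+1)) <= 6 x_i, because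
  an extended link stays independent when a hinge is added; the sum over i is
  |E(H)| + m <= 3 |X|, impossible for m >= 7.  If some s_j is 0, the ring opens
  into a chain, every hinge is a cut of at most two vertices and X lies in one
  link; then X contains no whole hinge, the new vertex would have degree at
  most 2 in H, so H avoids it and is a nucleation of the link without its
  hinges. *)

Set Implicit Arguments.
Unset Strict Implicit.
Unset Printing Implicit Defensive.

Import GRing.Theory Num.Theory.

Local Open Scope ring_scope.

(** * Rows of the rigidity matrix *)

Section Rank.
Variables (R : realType) (U : finType).
Implicit Types (p q : U -> 'rV[R]_3) (E F : {set {set U}}).

(** Rows are kept as vector-valued functions on the vertices, so the rows of all edge sets live in
    one space and an entry is read off at a vertex without enumeration indices. *)
Definition erow p (e : {set U}) : {ffun U -> 'rV[R]_3} :=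
  [ffun w => if w \in e then \sum_(x in e) (p w - p x) else 0].

Definition espan p E : {vspace {ffun U -> 'rV[R]_3}} :=
  <<[seq erow p e | e <- enum E]>>%VS.

Definition erank p E : nat := \dim (espan p E).

Lemma mem_espan p E e : e \in E -> erow p e \in espan p E.
Proof. by move=> eE; rewrite memv_span // map_f // mem_enum. Qed.

Lemma espan_subv p E (W : {vspace {ffun U -> 'rV[R]_3}}) :
  (forall e, e \in E -> erow p e \in W) -> (espan p E <= W)%VS.
Proof.
by move=> EW; apply/span_subvP => x /mapP[e]; rewrite mem_enum => /EW h ->.
Qed.

Lemma espanS p E F : E \subset F -> (espan p E <= espan p F)%VS.
Proof. by move=> /subsetP EF; apply: espan_subv => e /EF; apply: mem_espan. Qed.

Lemma espanU p E F : espan p (E :|: F) = (espan p E + espan p F)%VS.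
Proof.
apply/eqP; rewrite eqEsubv subv_add !espanS ?subsetUl ?subsetUr // !andbT.
apply: espan_subv => e /setUP[] eE.
  by apply: subvP (addvSl _ _) _ (mem_espan p eE).
by apply: subvP (addvSr _ _) _ (mem_espan p eE).
Qed.

Lemma erankS p E F : E \subset F -> (erank p E <= erank p F)%N.
Proof. by move=> EF; apply: dimvS; apply: espanS. Qed.

Lemma erank_card p E : (erank p E <= #|E|)%N.
Proof. by rewrite (leq_trans (dim_span _)) // size_map cardE. Qed.

(** Submodularity is the dimension formula for a sum of subspaces: the span over the common edges
    lies in the intersection of the two spans. *)
Lemma erank_modular p E F :
  (erank p (E :|: F) + erank p (E :&: F) <= erank p E + erank p F)%N.
Proof.
rewrite /erank espanU -[leqRHS]dimv_sum_cap leq_add2l dimvS //.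
by rewrite subv_cap !espanS ?subsetIl ?subsetIr.
Qed.

(** Independence as the absence of a nonzero self-stress, with coefficients indexed by edges instead
    of positions in an enumeration. *)
Lemma stress_freeP p E :
  reflect (forall w : {set U} -> R, \sum_(e in E) w e *: erow p e = 0 ->
             forall e, e \in E -> w e = 0)
          (erank p E == #|E|).
Proof.
have -> : (erank p E == #|E|) = free [seq erow p e | e <- enum E].
  by rewrite /free size_map -cardE.
apply: (iffP idP) => [fr w w0 e eE|st].
  have := @freeP _ _ _ (map_tuple (erow p) (enum_tuple (mem E))) fr.
  move=> /(_ (fun i => w (enum_val i))) h.
  rewrite -(enum_rankK_in eE eE); apply: h; rewrite -[RHS]w0.
  rewrite [RHS]big_enum_val /=; apply: eq_bigr => i _.
  by rewrite (nth_map set0) -?cardE // -enum_val_nth.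
apply/(@freeP _ _ _ (map_tuple (erow p) (enum_tuple (mem E)))) => k k0 i.
have iE := enum_valP i.
have := st (fun e => k (enum_rank_in iE e)).
move=> /(_ _ _ iE); rewrite enum_valK_in; apply.
rewrite -[RHS]k0 [LHS]big_enum_val /=; apply: eq_bigr => j _.
rewrite enum_valK_in (nth_map set0) -?cardE //.
by rewrite -(@enum_val_nth _ (mem E) set0 j).
Qed.

Lemma erank_indepS p E F : E \subset F -> erank p F = #|F| -> erank p E = #|E|.
Proof.
move=> EF /eqP/stress_freeP fr; apply/eqP/stress_freeP => w w0 e eE.
have := fr (fun e => if e \in E then w e else 0).
move=> /(_ _ e (subsetP EF _ eE)); rewrite eE; apply.
rewrite -[RHS]w0 (big_setID E) /= (setIidPr EF) [X in _ + X]big1 ?addr0.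
  by apply: eq_bigr => f ->.
by move=> f /setDP[_ /negPf ->]; rewrite scale0r.
Qed.

Lemma row_free_rigidity p E :
  row_free (rigidity_matrix p E) = (erank p E == #|E|).
Proof.
(* [L] flattens a row into the layout of [rigidity_matrix]. It is linear and injective, so both
   sides have the same stresses. *)
pose L (x : {ffun U -> 'rV[R]_3}) : 'rV[R]_(#|U| * 3) :=
  mxvec (\matrix_(j < #|U|, k < 3) x (enum_val j) 0 k).
have rowL i : row i (rigidity_matrix p E) = L (erow p (enum_val i)).
  apply/rowP => j; rewrite !mxE; congr (mxvec _ _ _).
  apply/matrixP => a b; rewrite !mxE ffunE /=; case: ifP => _; last by rewrite mxE.
  by rewrite summxE; apply: eq_bigr => x _; rewrite !mxE.
have L0 (w : {set U} -> R) :
    \sum_(i < #|E|) w (enum_val i) *: L (erow p (enum_val i))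
    = L (\sum_(e in E) w e *: erow p e).
  apply: (can_inj vec_mxK); apply/matrixP => a b.
  rewrite linear_sum /= summxE /L mxvecK mxE sum_ffunE summxE.
  rewrite [RHS]big_enum_val; apply: eq_bigr => i _.
  by rewrite linearZ /= mxvecK !mxE !ffunE !mxE.
have Linj x : L x = 0 -> x = 0.
  move=> Lx; apply/ffunP => w; apply/rowP => k; rewrite ffunE mxE.
  have := congr1 (fun M => vec_mx M (enum_rank w) k) Lx.
  by rewrite /L mxvecK !mxE enum_rankK.
apply/idP/stress_freeP => [fr w w0 e eE|st].
  have /row_free_inj inj := fr.
  have /(inj 1%N (\row_i w (enum_val i)) 0) :
    (\row_i w (enum_val i)) *m rigidity_matrix p E = 0 *m rigidity_matrix p E.
    rewrite mul0mx mulmx_sum_row.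
    under eq_bigr do rewrite rowL mxE.
    by rewrite L0 w0; apply: (can_inj vec_mxK); apply/matrixP => a b;
      rewrite mxvecK !mxE ffunE mxE.
  by move=> /rowP /(_ (enum_rank_in eE e)); rewrite !mxE enum_rankK_in.
rewrite -kermx_eq0; apply/eqP/row_matrixP => i.
rewrite row0; set v := row i _.
have : v *m rigidity_matrix p E = 0 by rewrite -row_mul mulmx_ker row0.
rewrite mulmx_sum_row; under eq_bigr do rewrite rowL.
move=> v0; apply/rowP => j; rewrite [RHS]mxE.
have jE := enum_valP j.
have := st (fun e => v 0 (enum_rank_in jE e)) _ _ jE.
rewrite enum_valK_in; apply; apply: Linj; rewrite -L0 -[RHS]v0.
by apply: eq_bigr => k _; rewrite enum_valK_in.
Qed.

End Rank.

(** * Generic placements *)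

Section Generic.
Variables (R : realType) (U : finType).
Implicit Types (p q : U -> 'rV[R]_3) (E F : {set {set U}}).

Local Notation poly := {mpoly rat[#|U| * 3]}.

Definition place_eval p : poly -> R :=
  mmap (ratr : rat -> R)
    (fun i => mxvec (\matrix_(j < #|U|, k < 3) p (enum_val j) 0 k) 0 i).

HB.instance Definition _ p := GRing.RMorphism.on (place_eval p).

Definition place_var (u : U) (k : 'I_3) : poly := 'X_(mxvec_index (enum_rank u) k).

Lemma place_evalX p u k : place_eval p (place_var u k) = p u 0 k.
Proof. by rewrite /place_eval mmapX mmap1U mxvecE mxE enum_rankK. Qed.

(** The determinant of [D] is a rational polynomial. Nonzero at [q], it is not the zero polynomial,
    hence it does not vanish at a generic placement. *)
Lemma generic_unitmx p q n (D : 'M[poly]_n) : generic p ->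
  map_mx (place_eval q) D \in unitmx -> map_mx (place_eval p) D \in unitmx.
Proof.
move=> gp; rewrite !unitmxE !unitfE !det_map_mx => Dq.
by apply: gp; apply: contraNneq Dq => ->; rewrite rmorph0.
Qed.

Definition poly_rigidity E : 'M[poly]_(#|E|, #|U| * 3) :=
  \matrix_(i < #|E|)
    mxvec (\matrix_(j < #|U|, k < 3)
      let e := enum_val i in let w := enum_val j in
      if w \in e then \sum_(x in e) (place_var w k - place_var x k) else 0).

Lemma map_poly_rigidity p E :
  map_mx (place_eval p) (poly_rigidity E) = rigidity_matrix p E.
Proof.
apply/row_matrixP => i; rewrite -map_row !rowK map_mxvec; congr mxvec.
apply/matrixP => j k; rewrite !mxE /=; case: ifP => _; last exact: rmorph0.
by rewrite rmorph_sum; apply: eq_bigr => x _; rewrite rmorphB; congr (_ - _);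
  exact: place_evalX.
Qed.

Lemma generic_row_free p q E : generic p ->
  row_free (rigidity_matrix q E) -> row_free (rigidity_matrix p E).
Proof.
move=> gp; rewrite /row_free -mxrank_tr => fq.
(* The columns [f] carry a nonzero maximal minor at [q]; the same columns give one at [p]. *)
have := @fullrowsub_unit _ _ _ _ fq; move: (fullrankfun fq) => f.
rewrite -(map_poly_rigidity q).
rewrite map_trmx -map_mxsub => /(generic_unitmx gp).
rewrite map_mxsub -map_trmx map_poly_rigidity -row_full_unit => h.
rewrite -mxrank_tr; apply/eqP/anti_leq; rewrite rank_leq_col /=.
by rewrite -[leqLHS](eqP h) mxrankS ?rowsub_sub.
Qed.

Lemma generic_erank p q E : generic p -> erank q E = #|E| -> erank p E = #|E|.
Proof.
by move=> gp /eqP; rewrite -row_free_rigidity => /(generic_row_free gp);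
  rewrite row_free_rigidity => /eqP.
Qed.

Lemma R3_indepP p E : generic p -> (R3_indep R E <-> erank p E = #|E|).
Proof.
move=> gp; split=> [[q gq]|/eqP h].
  by rewrite row_free_rigidity => /eqP; apply: generic_erank.
by exists p; rewrite ?row_free_rigidity.
Qed.

(** Take [F] of largest size among the independent subsets of [E]: an edge with row outside the span
    of [F] could be added to it. *)
Lemma erank_basis p E : exists F, [/\ F \subset E, erank p F = #|F| & #|F| =
  erank p E].
Proof.
pose P F := (F \subset E) && (erank p F == #|F|).
have P0 : P set0 by rewrite /P sub0set cards0 -leqn0 -[X in (_ <=
  X)%N](cards0 {set U}) erank_card.
case: (arg_maxnP (fun F : {set {set U}} => #|F|) P0) => F /andP[FE /eqP Ff] Fmax.
exists F; split=> //; rewrite -Ff; apply/eqP; rewrite eqn_leq erankS //=.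
apply: dimvS; apply: espan_subv => e eE.
have [eF|eF] := boolP (e \in F); first exact: mem_espan.
apply/negPn/negP => neF.
have /Fmax : P (e |: F).
  rewrite /P subUset sub1set eE FE /= eqn_leq erank_card cardsU1 eF -Ff.
  rewrite add1n /erank espanU ltnNge; apply: contra neF => le.
  have /eqP -> : (espan p F == espan p [set e] + espan p F)%VS.
    by rewrite eqEdim addvSr.
  by apply: subvP (addvSl _ _) _ (mem_espan _ _); rewrite inE.
by rewrite cardsU1 eF add1n => /(leq_trans (ltnSn _)); rewrite ltnn.
Qed.

(** From here on the matroid rank is computed at the single placement [p]. *)
Lemma R3_rankE p E : generic p -> R3_rank R E = erank p E.
Proof.
move=> gp; apply/eqP; rewrite eqn_leq; apply/andP; split.
  apply/bigmax_leqP => F /andP[FE /asboolP /(R3_indepP _ gp) <-]; exact: erankS.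
have [F [FE Ff <-]] := erank_basis p E.
by apply: leq_bigmax_cond; rewrite FE; apply/asboolP/(R3_indepP _ gp).
Qed.

(** Its rows are the differences from [a] to the other three points, so invertibility means that the
    four points are affinely independent. *)
Definition edge_mx p (a b c d : U) : 'M[R]_3 :=
  \matrix_(i < 3, k < 3) (p a 0 k - p (tnth [tuple b; c; d] i) 0 k).

Lemma generic_affine p a b c d : generic p -> uniq [:: a; b; c; d] ->
  edge_mx p a b c d \in unitmx.
Proof.
move=> gp abcd.
pose D : 'M[poly]_3 :=
  \matrix_(i < 3, k < 3) (place_var a k - place_var (tnth [tuple b; c; d] i) k).
have ED q : map_mx (place_eval q) D = edge_mx q a b c d.
  by apply/matrixP => i k; rewrite !mxE rmorphB; congr (_ - _); exact: place_evalX.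
(* This placement puts [a] at the origin and [b], [c], [d] at the negatives of the standard basis
   vectors. *)
pose q (u : U) : 'rV[R]_3 := \row_k - (u == tnth [tuple b; c; d] k)%:R.
rewrite -ED; apply: (generic_unitmx (q := q) gp); rewrite ED.
suff -> : edge_mx q a b c d = 1%:M by rewrite unitmx1.
move: abcd; rewrite /= !inE !negb_or => /and4P[/and3P[ab ac ad] /andP[bc bd] cd _].
have u3 : uniq [tuple b; c; d] by rewrite /= !inE negb_or bc bd cd.
apply/matrixP => i k; rewrite !mxE (inj_eq (tuple_uniqP _ u3)).
have -> : a == tnth [tuple b; c; d] k = false.
  apply/negbTE; apply: contraNneq ab => e.
  have : a \in [tuple b; c; d] by rewrite e mem_tnth.
  by rewrite !inE (negPf ac) (negPf ad) !orbF.
by rewrite oppr0 sub0r opprK.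
Qed.

End Generic.

(** * Complete graphs and Henneberg-II extensions *)

Section Pairs.
Variable U : finType.
Implicit Types (X Y T : {set U}) (E : {set {set U}}).

Definition star (v : U) T : {set {set U}} := [set [set v; w] | w in T].

Lemma pairsP X (e : {set U}) :
  reflect (exists a b, [/\ a != b, a \in X, b \in X & e = [set a; b]])
          (e \in pairs X).
Proof.
rewrite inE; apply: (iffP andP) => [[eX /cards2P[a [b [ab eab]]]]|].
  by move: eX; rewrite eab subUset !sub1set => /andP[aX bX]; exists a, b.
move=> [a [b [ab aX bX ->]]]; rewrite cards2 ab; split=> //.
by rewrite subUset !sub1set aX.
Qed.

Lemma pair_in X a b : ([set a; b] \in pairs X) = [&& a != b, a \in X & b \in X].
Proof.
rewrite inE subUset !sub1set cards2 andbC.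
by case: (a == b).
Qed.

Lemma pairsS X Y : X \subset Y -> pairs X \subset pairs Y.
Proof.
move=> XY; apply/subsetP => e; rewrite !inE => /andP[eX ->].
by rewrite (subset_trans eX).
Qed.

Lemma pairsI X Y : pairs (X :&: Y) = pairs X :&: pairs Y.
Proof. by apply/setP => e; rewrite !inE subsetI; case: (#|e| == 2);
  rewrite ?andbT ?andbF. Qed.

Lemma set2_inj (v : U) x y : [set v; x] = [set v; y] -> x = y.
Proof.
move=> e; have := set22 v x; have := set22 v y; rewrite e -{1}e !inE.
by case/orP=> /eqP -> // /orP[] /eqP.
Qed.

Lemma card_star (v : U) T : #|star v T| = #|T|.
Proof. by rewrite card_imset // => x y /set2_inj. Qed.

Lemma notin_star (v : U) T e Y : v \notin Y -> e \in pairs Y -> e \notin star v T.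
Proof.
move=> vY /pairsP[a [b [_ aY bY ->]]]; apply: contra vY => /imsetP[w _ ew].
have := set21 v w; rewrite -ew !inE.
by case/orP=> /eqP ->.
Qed.

Lemma star_disjoint (v : U) T E Y :
  v \notin Y -> E \subset pairs Y -> E :&: star v T = set0.
Proof.
move=> vY /subsetP EY; apply/setP => e; rewrite !inE; apply/negbTE.
by rewrite negb_and -implybE; apply/implyP => /EY; apply: notin_star.
Qed.

Lemma starU (v : U) (A B : {set U}) : star v (A :|: B) = star v A :|: star v B.
Proof. exact: imsetU. Qed.

Lemma pairs_cone (v : U) Y : v \notin Y -> pairs (v |: Y) = pairs Y :|: star v Y.
Proof.
move=> vY; apply/setP => e; rewrite in_setU; apply/idP/orP.
  case/pairsP => a [b [+ + + ->]]; rewrite !in_setU1.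
  case: (eqVneq a v) => [->|av] /=; case: (eqVneq b v) => [->|bv] //=.
  - by move=> _ _ bY; right; apply: imset_f.
  - by move=> _ aY _; right; rewrite setUC; apply: imset_f.
  by move=> ab aY bY; left; rewrite pair_in ab aY bY.
case=> [|/imsetP[w wY ->]]; first by apply/subsetP/pairsS/subsetUr.
rewrite pair_in !in_setU1 eqxx wY orbT !andbT.
by apply: contraNneq vY => ->.
Qed.

Lemma pairs_small X : (#|X| <= 1)%N -> pairs X = set0.
Proof.
move=> X1; apply/setP => e; rewrite !inE; apply/negbTE; rewrite negb_and -implybE.
apply/implyP => /subset_leq_card /leq_trans /(_ X1); by case: #|e| => [|[]].
Qed.

End Pairs.

Lemma sum_setU (V : zmodType) (I : finType) (A B : {set I}) (f : I -> V) :
  A :&: B = set0 ->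
  \sum_(i in A :|: B) f i = \sum_(i in A) f i + \sum_(i in B) f i.
Proof.
move=> AB0; rewrite -bigU /=; last by rewrite -setI_eq0 AB0.
by apply: eq_bigl => i; rewrite !inE.
Qed.

(** * Self-stresses and the ranks of stars, cones and complete graphs *)

Section Geometry.
Variables (R : realType) (U : finType).
Implicit Types (p q : U -> 'rV[R]_3) (E F : {set {set U}}) (X Y T : {set U}).

Lemma addfE (V : lmodType R) (x y : {ffun U -> V}) u : (x + y) u = x u + y u.
Proof. by rewrite ffunE. Qed.

Lemma scalefE (V : lmodType R) (k : R) (x : {ffun U -> V}) u :
  (k *: x) u = k *: x u.
Proof. by rewrite ffunE. Qed.

Lemma zerofE (V : lmodType R) u : (0 : {ffun U -> V}) u = 0.
Proof. by rewrite ffunE. Qed.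

Lemma erow0 p (e : {set U}) w : w \notin e -> erow p e w = 0.
Proof. by rewrite ffunE => /negPf ->. Qed.

Lemma erow2 p a b w : a != b ->
  erow p [set a; b] w = (w == a)%:R *: (p a - p b) + (w == b)%:R *: (p b - p a).
Proof.
move=> ab; rewrite ffunE !inE big_setU1 ?inE //= big_set1.
case: (eqVneq w a) => [->|wa] /=.
  by rewrite (negPf ab) subrr add0r scale1r scale0r addr0.
case: (eqVneq w b) => [->|wb] /=; last by rewrite !scale0r addr0.
by rewrite subrr scale1r scale0r add0r addr0.
Qed.

Lemma generic_affine_comb p a b c d (x y z : R) :
  generic p -> uniq [:: a; b; c; d] ->
  x *: (p a - p b) + y *: (p a - p c) + z *: (p a - p d) = 0 ->
  [/\ x = 0, y = 0 & z = 0].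
Proof.
move=> gp u4 eq0.
have := generic_affine gp u4; rewrite -row_free_unit => /row_free_inj inj.
pose r : 'rV[R]_3 := \row_i tnth [tuple x; y; z] i.
have /inj r0 : r *m edge_mx p a b c d = 0 *m edge_mx p a b c d.
  rewrite mul0mx -[RHS]eq0; apply/rowP => k.
  by rewrite !mxE !big_ord_recl big_ord0 !mxE /= addr0 addrA.
split.
- by have := congr1 (fun r : 'rV[R]_3 => r 0 0) r0; rewrite !mxE.
- by have := congr1 (fun r : 'rV[R]_3 => r 0 1) r0; rewrite !mxE.
by have := congr1 (fun r : 'rV[R]_3 => r 0 2) r0; rewrite !mxE.
Qed.

Lemma erow_eq p q (e : {set U}) : {in e, p =1 q} -> erow p e = erow q e.
Proof.
move=> pq; apply/ffunP => w; rewrite !ffunE; case: ifP => // we.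
by apply: eq_bigr => x xe; rewrite !pq.
Qed.

(* The edges va and vb of the new vertex at the midpoint of ab share their stress
   coefficient, and together act as half of the deleted edge ab. *)
Lemma henneberg_erank p E Y a b c d v : generic p ->
  E \subset pairs Y -> v \notin Y -> v \notin [:: a; b; c; d] ->
  uniq [:: a; b; c; d] -> [set a; b] \in E -> erank p E = #|E| ->
  let E' := (E :\ [set a; b]) :|: star v [set a; b; c; d] in
  erank p E' = #|E'|.
Proof.
move=> gp EY vY vW u4 abE /eqP/stress_freeP st E'.
have /and4P[/and3P[ab ac ad] /andP[bc bd] cd _] :
    [&& [&& a != b, a != c & a != d], (b != c) && (b != d), c != d & true].
  by move: u4; rewrite /= !inE !negb_or.
have [va vb vc vd] : [/\ v != a, v != b, v != c & v != d].
  by move: vW; rewrite !inE !negb_or => /and4P.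
pose q u := if u == v then 2^-1 *: (p a + p b) else p u.
have qv : q v = 2^-1 *: (p a + p b) by rewrite /q eqxx.
have qE u : v != u -> q u = p u by rewrite /q eq_sym => /negPf ->.
have EqE e : e \in E -> erow q e = erow p e.
  move=> /(subsetP EY); rewrite inE => /andP[/subsetP eY _].
  by apply: erow_eq => u /eY uY; apply: qE; apply: contraNneq vY => ->.
have dis : (E :\ [set a; b]) :&: star v [set a; b; c; d] = set0.
  by apply: (star_disjoint _ vY); apply: subset_trans EY; apply: subsetDl.
have sumE' (V : zmodType) (f : {set U} -> V) : \sum_(e in E') f e =
    \sum_(e in E :\ [set a; b]) f e
    + (f [set v; a] + f [set v; b] + f [set v; c] + f [set v; d]).
  rewrite sum_setU //; congr (_ + _); rewrite big_imset => [|x y _ _ /set2_inj //].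
  rewrite -!setUA !big_setU1 ?inE ?negb_or ?ab ?ac ?ad ?bc ?bd ?cd //=.
  by rewrite big_set1 !addrA.
(* Since [p] is generic, independence at the special placement [q] suffices. *)
apply: (generic_erank gp (q := q)); apply/eqP/stress_freeP => w.
rewrite sumE' => w0.
have [wc wd wab] : [/\ w [set v; c] = 0, w [set v; d] = 0
    & w [set v; b] = w [set v; a]].
  have := congr1 (fun x : {ffun U -> 'rV[R]_3} => x v) w0.
  rewrite !addfE sum_ffunE big1 => [|e /setD1P[_ eE]]; last first.
    rewrite scalefE EqE // erow0 ?scaler0 //.
    by apply: contra vY; apply: subsetP; have := subsetP EY _ eE;
      rewrite inE => /andP[].
  rewrite !scalefE zerofE.
  rewrite !erow2 // eqxx (negPf va) (negPf vb) (negPf vc) (negPf vd).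
  rewrite !scale1r !scale0r !addr0 add0r qv !qE // => eq0.
  (* Equilibrium at [v], with the midpoint substituted, is written in the three differences
     [p a - p b], [p a - p c] and [p a - p d]. *)
  have := @generic_affine_comb p a b c d
    (2^-1 * (w [set v; b] - w [set v; a] - w [set v; c] - w [set v; d]))
    (w [set v; c]) (w [set v; d]) gp u4.
  case.
    by rewrite -[RHS]eq0; apply/rowP => k; rewrite !mxE; field.
  move=> h c0 d0; move: h; rewrite c0 d0 => /eqP;
    rewrite mulf_eq0 invr_eq0 pnatr_eq0 /= !subr0 subr_eq0.
  by move/eqP ->.
have := st (fun e => if e == [set a; b] then 2^-1 * w [set v; a] else w e).
rewrite (big_setD1 _ abE) /= eqxx.
under eq_bigr => e /setD1P[/negPf eab eE] do rewrite eab -EqE //.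
have -> : (2^-1 * w [set v; a]) *: erow p [set a; b]
    = w [set v; a] *: erow q [set v; a] + w [set v; b] *: erow q [set v; b]
      + w [set v; c] *: erow q [set v; c] + w [set v; d] *: erow q [set v; d].
  rewrite wc wd wab !scale0r !addr0 mulrC -scalerA -scalerDr; congr (_ *: _).
  apply/ffunP => u; rewrite addfE scalefE !erow2 // qv !qE //.
  apply/rowP => k; rewrite !mxE.
  case: (eqVneq u v) => [->|uv]; first
    by rewrite (negPf va) (negPf vb) ?mulr1n ?mulr0n; field.
  by case: (u == a); case: (u == b); rewrite ?mulr1n ?mulr0n; field.
rewrite addrC => /(_ w0) w'0 e; rewrite !inE.
case/orP => [/andP[eab eE]|/imsetP[x]].
  by have := w'0 e eE; rewrite (negPf eab).
have wa : w [set v; a] = 0.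
  by have := w'0 _ abE; rewrite eqxx => /eqP;
    rewrite mulf_eq0 invr_eq0 pnatr_eq0 => /eqP.
rewrite !inE -!orbA => /or4P[] /eqP -> ->; rewrite ?wc ?wd ?wab ?wa //.
Qed.

(* An affine dependency l of the points yields the self-stress l_x l_y of the
   complete graph; erank_cone uses it for five points. *)
Lemma complete_stress p X (l : U -> R) :
  \sum_(x in X) l x = 0 -> \sum_(x in X) l x *: p x = 0 ->
  \sum_(e in pairs X) (\prod_(x in e) l x) *: erow p e = 0.
Proof.
move=> l0 lp0; apply/ffunP => w; rewrite zerofE sum_ffunE.
have [wX|wX] := boolP (w \in X); last first.
  rewrite big1 // => e; rewrite inE => /andP[/subsetP eX _].
  by rewrite scalefE erow0 ?scaler0 //; apply: contra wX => /eX.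
move: l0 lp0; rewrite -(setD1K wX); set Y := X :\ w.
have wY : w \notin Y by rewrite !inE eqxx.
rewrite !big_setU1 //= => l0 lp0.
rewrite pairs_cone // sum_setU ?(star_disjoint _ wY) // big1 ?add0r; last first.
  move=> e; rewrite inE => /andP[/subsetP eY _].
  by rewrite scalefE erow0 ?scaler0 //; apply: contra wY => /eY.
rewrite big_imset => [|x y _ _ /set2_inj //] /=.
under eq_bigr => x xY.
  have wx : w != x by apply: contraNneq wY => ->.
  rewrite scalefE erow2 // eqxx (negPf wx) scale1r scale0r addr0.
  rewrite big_setU1 ?inE //= big_set1 -scalerA scalerBr.
  over.
rewrite -scaler_sumr big_split /= -scaler_suml sumrN.
(* Over the vertices other than [w], the sums of [l x] and of [l x *: p x] are [- l w] and
   [- l w *: p w], and the two contributions at [w] cancel. *)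
have /eqP := l0; rewrite addrC addr_eq0 => /eqP ->.
have /eqP := lp0; rewrite addrC addr_eq0 => /eqP ->.
by rewrite opprK scaleNr addNr scaler0.
Qed.

(** Evaluation at [v] kills the row of every edge that avoids [v], which separates a star at [v]
    from the rest of the graph. *)
Definition eval_at (v : U) (x : {ffun U -> 'rV[R]_3}) : 'rV[R]_3 := x v.

Fact eval_at_is_linear v : linear (eval_at v).
Proof. by move=> k x y; rewrite /eval_at !ffunE. Qed.

HB.instance Definition _ v :=
  GRing.isLinear.Build R {ffun U -> 'rV[R]_3} 'rV[R]_3 _ (eval_at v)
    (eval_at_is_linear v).

Lemma erankU_card p E F : (erank p (E :|: F) <= erank p E + #|F|)%N.
Proof.
apply: leq_trans (leq_trans (leq_addr _ _) (erank_modular p E F)) _.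
by rewrite leq_add2l erank_card.
Qed.

(** Rank-nullity for evaluation at [v]: its kernel contains the span of [E], and the three star rows
    are sent to independent vectors because [v] and [T] are in general position. *)
Lemma erank_star3 p E Y T v : generic p -> E \subset pairs Y ->
  v \notin Y -> v \notin T -> #|T| = 3%N ->
  erank p (E :|: star v T) = (erank p E + 3)%N.
Proof.
move=> gp EY vY vT T3; apply/eqP; rewrite eqn_leq.
rewrite (leq_trans (erankU_card _ _ _)) ?card_star ?T3 //=.
pose f := linfun (eval_at v); rewrite {2}/erank -(limg_ker_dim f) leq_add //.
  apply: dimvS; rewrite subv_cap espanS ?subsetUl //=.
  apply: espan_subv => e eE; rewrite memv_ker lfunE /= /eval_at erow0 //.
  apply: contra vY; apply: subsetP.
  by have := subsetP EY e eE; rewrite inE => /andP[].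
move: T3; rewrite cardE; case: (enum T) (enum_uniq T) (mem_enum T) =>
  [|a [|b [|c [|]]]] //.
move=> u3 memT _.
have u4 : uniq [:: v; a; b; c] by rewrite cons_uniq u3 andbT memT.
have fr : free [:: p v - p a; p v - p b; p v - p c].
  apply/(@freeP _ _ 3 [tuple p v - p a; p v - p b; p v - p c]) => k.
  rewrite !big_ord_recl big_ord0 /= addr0 addrA.
  case/(generic_affine_comb gp u4) => k0 k1 k2 i.
  case: i => [[|[|[|//]]] lt]; [rewrite -[RHS]k0|rewrite -[RHS]k1|rewrite -[RHS]k2];
  by congr k; apply: val_inj.
apply: (@leq_trans (\dim <<[:: p v - p a; p v - p b; p v - p c]>>)).
  by move: fr; rewrite /free => /eqP ->.
apply: dimvS; apply/span_subvP => x xin.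
have [y yT ->] : exists2 y, y \in T & x = p v - p y.
  by move: xin; rewrite !inE => /or3P[] /eqP ->; [exists a|exists b|exists c];
    rewrite // -memT !inE eqxx ?orbT.
have vy : v != y by apply: contraNneq vT => ->.
have -> : p v - p y = f (erow p [set v; y]).
  by rewrite lfunE /= /eval_at erow2 // eqxx (negPf vy) scale1r scale0r addr0.
by apply/memv_img/mem_espan/setUP; right; apply: imset_f.
Qed.

(** Enlarge [T] to three vertices: the full star adds 3 to the rank and the extra edges add at most
    one each, so the edges to [T] cannot add less than [#|T|]. *)
Lemma erank_star p E Y T v : generic p -> (4 <= #|U|)%N -> E \subset pairs Y ->
  v \notin Y -> v \notin T -> (#|T| <= 3)%N ->
  erank p (E :|: star v T) = (erank p E + #|T|)%N.
Proof.
move=> gp U4 EY vY vT T3; apply/eqP; rewrite eqn_leq.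
rewrite (leq_trans (erankU_card _ _ _)) ?card_star //=.
have [T' [T'T vT' cT']] : exists T', [/\ T \subset T', v \notin T' & #|T'| = 3%N].
  have : (3 - #|T| <= #|~: (v |: T)|)%N.
    by have := cardsC (v |: T); rewrite cardsU1 vT; lia.
  case/card_geqP => s [us ss sA]; exists (T :|: [set:: s]).
  rewrite subsetUl in_setU negb_or vT inE; split=> //.
    by apply/negP => /sA; rewrite !inE eqxx.
  rewrite cardsU (_ : T :&: _ = set0) ?cards0 ?cardsE; last first.
    apply/setP => x; rewrite !inE; apply/negP => /andP[xT /sA].
    by rewrite !inE xT orbT.
  by rewrite (card_uniqP us) ss; lia.
have := erank_star3 gp EY vY vT' cT'.
rewrite -(setID T' T) (setIidPr T'T) starU setUA.
have := erankU_card p (E :|: star v T) (star v (T' :\: T)).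
by rewrite card_star cardsD (setIidPr T'T) cT'; lia.
Qed.

(* 3n - 6, corrected for n = 2; the truncated subtraction gives 0 for n < 2. *)
Definition complete_rank n := (3 * n - 6 + (n == 2))%N.

(** Three edges from [v] add 3. Any further edge [vu] is already spanned: the five points [v], [u],
    [a], [b], [c] of space are affinely dependent, and the resulting stress of their complete graph
    is nonzero on [vu]. *)
Lemma erank_cone p Y v : generic p -> v \notin Y -> (3 <= #|Y|)%N ->
  erank p (pairs (v |: Y)) = (erank p (pairs Y) + 3)%N.
Proof.
move=> gp vY /card_geqP[s [us s3 sY]].
have sE : #|[set:: s]| = 3%N by rewrite cardsE (card_uniqP us).
have vs : v \notin [set:: s] by rewrite inE; apply: contra vY; apply: sY.
rewrite -(erank_star3 gp (subxx (pairs Y)) vY vs sE).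
apply/eqP; rewrite eqn_leq; apply/andP; split; last first.
  apply: erankS; rewrite pairs_cone // setUS //; apply/subsetP => e /imsetP[x].
  by rewrite inE => /sY xY ->; apply: imset_f.
apply: dimvS; apply: espan_subv => e; rewrite pairs_cone // => /setUP[eY|].
  by apply/mem_espan/setUP; left.
case/imsetP => u uY ->.
have [us'|us'] := boolP (u \in s).
  by apply/mem_espan/setUP; right; apply: imset_f; rewrite inE.
case: s us s3 sY us' {sE vs} => [|a [|b [|c [|]]]] // us3 _ sY us'.
set W := espan _ _.
have u4 : uniq [:: u; a; b; c] by rewrite cons_uniq us3 us'.
have v4 : uniq [:: v; a; b; c].
  by rewrite cons_uniq us3 andbT; apply: contra vY; apply: sY.
have uv : u != v by apply: contraNneq vY => <-.
have [x [y [z vu]]] : exists x y z,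
    x *: (p v - p a) + y *: (p v - p b) + z *: (p v - p c) = p v - p u.
  pose r := (p v - p u) *m invmx (edge_mx p v a b c).
  exists (r 0 0), (r 0 1), (r 0 2).
  have := mulmxKV (generic_affine gp v4) (p v - p u); rewrite -/r => <-.
  move: r => r.
  apply/rowP => k; rewrite !mxE !big_ord_recl big_ord0 !mxE /= addr0 addrA.
  by congr (_ * _ + _ * _ + _ * _); congr (r 0 _); apply: val_inj.
have /and5P[] : [&& v != u, v != a, v != b, v != c & uniq [:: u; a; b; c]].
  by rewrite u4 eq_sym uv; move: v4; rewrite /= !inE !negb_or =>
    /andP[/and3P[-> -> ->]].
move=> vu' va vb vc; rewrite /= !inE !negb_or =>
  /and4P[/and3P[ua ub uc] /andP[ab ac] bc _].
(* The affine dependency read off from [vu], normalised to -1 at [u]. *)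
pose l w := if w == v then 1 - x - y - z else if w == u then -1 else
  if w == a then x else if w == b then y else z.
have [lv lu la lb lc] : [/\ l v = 1 - x - y - z, l u = -1, l a = x, l b =
  y & l c = z].
  rewrite /l !eqxx (eq_sym u) (eq_sym a) (eq_sym b) (eq_sym c) (negPf vu').
  rewrite (eq_sym a) (eq_sym b) (eq_sym c) (negPf va) (negPf vb) (negPf vc).
  rewrite (eq_sym b) (eq_sym c) (negPf ua) (negPf ub) (negPf uc).
  by rewrite (eq_sym c) (negPf ab) (negPf ac) (negPf bc).
pose Z := [set u; a; b; c].
have vZ : v \notin Z by rewrite !inE !negb_or vu' va vb vc.
have ZY : Z \subset Y.
  by apply/subsetP => w; rewrite !inE -!orbA => /or4P[] /eqP -> //; apply: sY;
    rewrite !inE eqxx ?orbT.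
have sumZ (V : zmodType) (f : U -> V) :
    \sum_(w in v |: Z) f w = f v + (f u + (f a + (f b + f c))).
  rewrite big_setU1 //= /Z -!setUA !big_setU1 ?inE ?negb_or ?ua ?ub ?uc ?ab ?ac ?bc //=.
  by rewrite big_set1.
have := @complete_stress p (v |: Z) l.
rewrite !sumZ lv lu la lb lc => /(_ _ _)/wrap[]; first by ring.
  apply/rowP => k; have := congr1 (fun r : 'rV[R]_3 => r 0 k) vu.
  by rewrite !mxE; lra.
have e0X : [set v; u] \in pairs (v |: Z).
  by rewrite pair_in vu' !inE !eqxx ?orbT.
rewrite (big_setD1 _ e0X) /= big_setU1 ?inE //= big_set1 lv lu mulrN1.
move/eqP; rewrite addr_eq0 => /eqP eW.
(* A zero coefficient at [v] would leave an affine dependency among the generic points [u], [a],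
   [b], [c]. *)
have lv0 : - (1 - x - y - z) != 0.
  rewrite oppr_eq0; apply/eqP => lv0.
  have [] := @generic_affine_comb p u a b c x y z gp u4.
    apply/rowP => k; have := congr1 (fun r : 'rV[R]_3 => r 0 k) vu.
    rewrite !mxE => h.
    transitivity ((1 - x - y - z) * (p v 0 k - p u 0 k)); first by lra.
    by rewrite lv0 mul0r.
  by move=> x0 y0 z0; move: lv0; rewrite x0 y0 z0 !subr0 => /eqP; rewrite oner_eq0.
rewrite -(scalerK lv0 (erow p [set v; u])) eW; apply/memvZ; rewrite memvN.
apply: memv_suml => e1; rewrite !inE => /andP[e0 eX]; apply/memvZ/mem_espan.
have : e1 \in pairs (v |: Z) by rewrite inE.
rewrite pairs_cone // => /setUP[/(subsetP (pairsS ZY)) eY|].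
  by apply/setUP; left.
case/imsetP => w wZ ew; apply/setUP; right; rewrite ew; apply: imset_f.
move: wZ e0; rewrite ew !inE -!orbA => /or4P[] /eqP ->; rewrite ?eqxx ?orbT //.
Qed.

(** Build the complete graph one vertex at a time: [erank_star] counts the new edges up to three
    vertices, and from then on [erank_cone] adds 3 each time. *)
Lemma erank_pairs p X : generic p -> (4 <= #|U|)%N ->
  erank p (pairs X) = complete_rank #|X|.
Proof.
move=> gp U4; have [n] := ubnP #|X|; elim: n X => // n IH X Xn.
have [X1|X2] := leqP #|X| 1.
  rewrite pairs_small // /complete_rank; have := erank_card p set0.
  by rewrite cards0; case: #|X| X1 => [|[|]] //; lia.
have [a aX] : exists a, a \in X by apply/card_gt0P; lia.
pose Y := X :\ a; have aY : a \notin Y by rewrite !inE eqxx.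
have XE : X = a |: Y by rewrite setD1K.
have YX : #|X| = #|Y|.+1 by rewrite XE cardsU1 aY.
have EY : erank p (pairs Y) = complete_rank #|Y| by apply: IH; lia.
rewrite {1}XE YX; have [Y2|Y3] := leqP #|Y| 2.
  rewrite pairs_cone // (erank_star gp U4 (subxx _)) // ?EY; last by lia.
  by case: #|Y| YX Y2 => [|[|[|]]] //; lia.
by rewrite erank_cone // EY /complete_rank; lia.
Qed.

End Geometry.

(** * Relabelling *)

Section Relabel.
Variables (R : realType) (U : finType).
Implicit Types (p q : U -> 'rV[R]_3) (E F : {set {set U}}) (V : {set U}).

Lemma imset_set_inj (g : U -> U) V : {in V &, injective g} ->
  {in pairs V &, injective (fun e : {set U} => g @: e)}.
Proof.
have sub e e' : e \in pairs V -> e' \in pairs V -> {in V &, injective g} ->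
    g @: e = g @: e' -> e \subset e'.
  rewrite !inE => /andP[/subsetP eV _] /andP[/subsetP e'V _] gI ee'.
  apply/subsetP => x xe; have := imset_f g xe; rewrite ee' => /imsetP[y ye' xy].
  by rewrite (gI x y (eV x xe) (e'V y ye') xy).
by move=> gI e e' eV e'V ee'; apply/eqP; rewrite eqEsubset !sub.
Qed.

Lemma pairs_imset (g : U -> U) V : {in V &, injective g} ->
  [set g @: (e : {set U}) | e in pairs V] = pairs (g @: V).
Proof.
move=> gI; apply/setP => e; apply/imsetP/pairsP.
  case=> _ /pairsP[a [b [ab aV bV ->]]] ->; exists (g a), (g b).
  by rewrite imsetU1 imset_set1 !imset_f // (inj_in_eq gI).
case=> x [y [xy /imsetP[a aV xa] /imsetP[b bV yb] ->]]; subst x y.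
exists [set a; b]; last by rewrite imsetU1 imset_set1.
by rewrite pair_in aV bV !andbT; apply: contraNneq xy => ->.
Qed.

(** The placement [p \o g] gives [F] the rows that [p] gives the image of [F], so [F] is independent
    there and hence at the generic [p]. *)
Lemma relabel_indep p (g : U -> U) V F : generic p -> {in V &, injective g} ->
  F \subset pairs V -> let gF := [set g @: (e : {set U}) | e in F] in
  erank p gF = #|gF| -> erank p F = #|F|.
Proof.
move=> gp gI FV gF /eqP/stress_freeP st.
apply: (generic_erank gp (q := p \o g)); apply/eqP/stress_freeP => w w0 e eF.
have injF : {in F &, injective (fun e : {set U} => g @: e)}.
  by apply: sub_in2 (imset_set_inj gI); apply: (subsetP FV).
have eV e' : e' \in F -> e' \subset V.
  by move/(subsetP FV); rewrite inE => /andP[].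
pose h (e' : {set U}) := V :&: g @^-1: e'.
have hK e' : e' \in F -> h (g @: e') = e'.
  move=> /eV/subsetP e'V; apply/setP => x; rewrite !inE; apply/andP/idP.
    by case=> xV /imsetP[y ye xy]; rewrite (gI x y xV (e'V y ye) xy).
  by move=> xe; rewrite e'V // imset_f.
rewrite -(hK e eF); apply: (st (fun e' => w (h e'))); last exact: imset_f.
rewrite big_imset //=; under eq_bigr => e' e'F do rewrite hK //.
apply/ffunP => y; rewrite zerofE sum_ffunE.
have [/imsetP[x xV ->]|yV] := boolP (y \in g @: V).
  have := congr1 (fun r : {ffun U -> 'rV[R]_3} => r x) w0.
  rewrite zerofE sum_ffunE => wx; rewrite -[RHS]wx; apply: eq_bigr => e' e'F.
  rewrite !scalefE; congr (_ *: _); rewrite !ffunE.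
  have e'V := subsetP (eV e' e'F).
  have -> : (g x \in g @: e') = (x \in e').
    apply/imsetP/idP => [[z ze xz]|xe]; last by exists x.
    by rewrite (gI x z xV (e'V z ze) xz).
  case: ifP => // _; rewrite big_imset // => a b aV bV; apply: gI; exact: e'V.
rewrite big1 // => e' e'F; rewrite scalefE erow0 ?scaler0 //.
by apply: contra yV; apply/subsetP/imsetS/eV.
Qed.

Lemma erank_relabel_le p (g : U -> U) V F : generic p -> {in V &, injective g} ->
  F \subset pairs V ->
  (erank p [set g @: (e : {set U}) | e in F] <= erank p F)%N.
Proof.
move=> gp gI FV; have [B [BF Bi <-]] := erank_basis p [set g @: (e :
  {set U}) | e in F].
pose B0 := [set e in F | g @: e \in B].
have B0F : B0 \subset F by apply/subsetP => e; rewrite inE => /andP[].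
have EB : [set g @: (e : {set U}) | e in B0] = B.
  apply/setP => e; apply/imsetP/idP => [[e']|eB]; first by rewrite inE =>
    /andP[_ h] ->.
  have /imsetP[e' e'F ee'] := subsetP BF e eB.
  by exists e' => //; rewrite inE e'F -ee'.
have := relabel_indep gp gI (subset_trans B0F FV); rewrite /= EB => /(_ Bi) B0i.
by rewrite -EB (leq_trans (leq_imset_card _ _)) // -B0i erankS.
Qed.

Lemma erank_relabel p (g : U -> U) V F : generic p -> {in V &, injective g} ->
  F \subset pairs V ->
  erank p [set g @: (e : {set U}) | e in F] = erank p F.
Proof.
move=> gp gI FV; apply/eqP; rewrite eqn_leq (erank_relabel_le gp gI FV) /=.
(* [g'] inverts [g] on [V]; relabelling back along it gives the reverse inequality. *)
pose g' y := if [pick x in V | g x == y] is Some x then x else y.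
have g'K : {in V, cancel g g'}.
  move=> x xV; rewrite /g'; case: pickP => [z /andP[zV /eqP]|/(_ x)];
    first exact: gI.
  by rewrite xV eqxx.
have g'I : {in g @: V &, injective g'}.
  by move=> _ _ /imsetP[x xV ->] /imsetP[y yV ->]; rewrite !g'K // => ->.
have gFV : [set g @: (e : {set U}) | e in F] \subset pairs (g @: V).
  by rewrite -(pairs_imset gI); apply: imsetS.
apply: leq_trans (erank_relabel_le gp g'I gFV).
rewrite -imset_comp; apply: erankS; apply/subsetP => e eF; apply/imsetP.
exists e => //=; have := subsetP FV e eF; rewrite inE => /andP[/subsetP eV _].
rewrite -imset_comp -[LHS](imset_id e); apply: eq_in_imset => x /eV /g'K /= -> //.
Qed.

End Relabel.

Local Close Scope ring_scope.
Local Open Scope nat_scope.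

(** * Rings of links *)

Section Cut.
Variables (R : realType) (U : finType).
Implicit Types (p : U -> 'rV[R]_3) (E : {set {set U}}) (A B X : {set U}).

(** Two bodies that share at most two vertices still move relative to each other: by submodularity
    the rank falls short of that of the complete graph on [A :|: B] unless one set contains the
    other. *)
Lemma rigid_cut p A B E : generic p -> 4 <= #|U| ->
  E \subset pairs A :|: pairs B -> #|A :&: B| <= 2 ->
  complete_rank #|A :|: B| <= erank p E -> A \subset B \/ B \subset A.
Proof.
move=> gp U4 EAB o2 le.
have := leq_trans le (erankS p EAB).
have := erank_modular p (pairs A) (pairs B).
rewrite -pairsI !erank_pairs // cardsU /complete_rank.
have oA := subset_leq_card (subsetIl A B);
  have oB := subset_leq_card (subsetIr A B).
move=> h1 h2.
have [hA|hB] : #|A| <= #|A :&: B| \/ #|B| <= #|A :&: B| by lia.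
  by left; apply/setIidPl/eqP; rewrite eqEcard subsetIl.
by right; apply/setIidPr/eqP; rewrite eqEcard subsetIr.
Qed.
End Cut.

Lemma ordS_val m (i : 'I_m) : ordS i = (if i.+1 == m then 0 else i.+1) :> nat.
Proof.
rewrite /=; case: eqP => [->|im]; first by rewrite modnn.
by rewrite modn_small //; have := ltn_ord i; lia.
Qed.

Lemma ordS_neq m (i : 'I_m) : 2 < m -> ordS i != i.
Proof.
move=> m2; apply/eqP => /(congr1 (@nat_of_ord m)); rewrite ordS_val.
by move: (ltn_ord i); case: ifP; lia.
Qed.

Lemma ordSS_neq m (i : 'I_m) : 2 < m -> ordS (ordS i) != i.
Proof.
move=> m2; apply/eqP => /(congr1 (@nat_of_ord m)); rewrite !ordS_val.
by move: (ltn_ord i); repeat case: ifP; lia.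
Qed.

Section RingOfLinks.
Variables (R : realType) (U : finType) (m : nat).
Variables (V h : 'I_m -> {set U}) (F : 'I_m -> {set {set U}}) (v : 'I_m -> U).
Variable p : U -> 'rV[R]_3.

Definition corners i := h i :|: h (ordS i).
Definition ext_verts i := v i |: V i.
Definition ext_edges i := F i :|: star (v i) (corners i).
Definition hinge_set : {set {set U}} := [set h i | i : 'I_m].
Definition ext_ring := \bigcup_i ext_edges i.

Local Notation L := ext_verts.
Local Notation W := corners.
Local Notation S := ext_edges.
Local Notation hs := hinge_set.
Local Notation E' := ext_ring.

(* h i is the hinge shared by link i and its predecessor, V i and F i are the
   vertices and the non-hinge edges of link i, and v i is its new vertex. *)
Hypotheses (m7 : 7 <= m) (gp : generic p) (U4 : 4 <= #|U|).
Hypotheses (h2 : forall i, #|h i| = 2) (WV : forall i, W i \subset V i)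
  (h_disj : forall i, h i :&: h (ordS i) = set0)
  (V_meet : forall i j x, i != j -> x \in V i -> x \in V j ->
     (j = ordS i /\ x \in h j) \/ (i = ordS j /\ x \in h i)).
Hypotheses (FV : forall i, F i \subset pairs (V i))
  (hF : forall i j, h j \notin F i).
Hypotheses (vV : forall i j, v i \notin V j) (v_inj : injective v).
Hypothesis ring_indep : let E := hs :|: \bigcup_i F i in erank p E = #|E|.

Lemma hinge_sub i : h i \subset V i.
Proof. exact: subset_trans (subsetUl _ _) (WV i). Qed.

Lemma next_hinge_sub i : h (ordS i) \subset V i.
Proof. exact: subset_trans (subsetUr _ _) (WV i). Qed.

Lemma hinge_sub_ext i x : x \in h i -> x \in L i.
Proof. by move=> /(subsetP (hinge_sub i)) xV; rewrite !inE xV orbT. Qed.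

Lemma m_gt2 : 2 < m.
Proof. exact: leq_trans m7. Qed.

(** Each new vertex is private to its link, so extended links meet only where the original links
    do. *)
Lemma ext_verts_meet i j x : i != j -> x \in L i -> x \in L j ->
  (j = ordS i /\ x \in h j) \/ (i = ordS j /\ x \in h i).
Proof.
move=> ij; rewrite !inE => /orP[/eqP->|xi] /orP[/eqP|xj].
- by move/v_inj => e; rewrite e eqxx in ij.
- by move: (vV i j); rewrite xj.
- by move=> e; move: (vV j i); rewrite -e xi.
exact: V_meet.
Qed.

Lemma ext_verts_hinge i j x : x \in h j -> x \in L i -> i = j \/ ordS i = j.
Proof.
move=> xj xi; case: (eqVneq i j) => [|ij]; first by left.
case: (ext_verts_meet ij xi (hinge_sub_ext xj)) => [[]|[e xi']]; first by right.
have : x \in h j :&: h (ordS j) by rewrite inE xj -e.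
by rewrite h_disj inE.
Qed.

Lemma hinge_eq i j x : x \in h i -> x \in h j -> i = j.
Proof.
move=> xi xj; case: (ext_verts_hinge xj (hinge_sub_ext xi)) => // e.
have : x \in h i :&: h (ordS i) by rewrite inE xi e.
by rewrite h_disj inE.
Qed.

Lemma next_hinge_neq i : h i != h (ordS i).
Proof.
apply/eqP => e; have := h_disj i; rewrite -e setIid => /eqP; rewrite -cards_eq0.
by rewrite h2.
Qed.

(* Summed over x in X, this reads sum_i x_i = |X| + sum_j s_j. *)
Lemma ext_verts_multiplicity x : (exists i, x \in L i) ->
  \sum_i (x \in L i : nat) = 1 + \sum_j (x \in h j : nat).
Proof.
case=> i xi; have [/existsP[j xj]|nh] := boolP [exists j, x \in h j].
  have -> : \sum_j (x \in h j : nat) = 1.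
    rewrite (bigD1 j) //= xj big1 ?addn0 // => k /eqP kj.
    by apply/eqP; rewrite eqb0; apply/negP => /hinge_eq /(_ xj).
  (* A vertex on hinge [j] lies in exactly two links, [j] and its predecessor [k]. *)
  pose k := ord_pred j; have kj : ordS k = j by rewrite /k ord_predK.
  have jk : k != j by rewrite -kj eq_sym (ordS_neq _ m_gt2).
  rewrite (bigD1 j) //= hinge_sub_ext // (bigD1 k) //= big1 ?addn0.
    by rewrite !inE (subsetP (next_hinge_sub k)) ?kj ?orbT.
  move=> l /andP[lj lk]; apply/eqP; rewrite eqb0; apply/negP =>
    /(ext_verts_hinge xj)[e|e].
    by rewrite e eqxx in lj.
  by rewrite /k -e ordSK eqxx in lk.
have nh' j : x \in h j = false.
  by apply/negbTE; apply: contra nh => xj; apply/existsP; exists j.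
rewrite [X in 1 + X]big1 => [|j _]; last by rewrite nh'.
rewrite (bigD1 i) //= xi big1 // => j ji; apply/eqP; rewrite eqb0; apply/negP => xj.
by case: (ext_verts_meet ji xj xi) => -[_]; rewrite nh'.
Qed.

(** With more than two links, two distinct links share at most one hinge, so both ends of [e] lie on
    the same one. *)
Lemma shared_pair_is_hinge i j (e : {set U}) : i != j -> e \subset L i ->
  e \subset L j ->
  #|e| = 2 -> exists k, e = h k.
Proof.
move=> ij /subsetP ei /subsetP ej e2.
have sub k : {subset e <= h k} -> e = h k.
  by move=> /subsetP ek; apply/eqP; rewrite eqEcard ek h2 e2.
case: (eqVneq j (ordS i)) => [jE|jn].
  exists j; apply: sub => x xe;
    case: (ext_verts_meet ij (ei x xe) (ej x xe)) => -[] // iE.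
  by move: (ordSS_neq i m_gt2); rewrite -jE -iE eqxx.
exists i; apply: sub => x xe; case: (ext_verts_meet ij (ei x xe) (ej x xe)) =>
  -[] // e0.
by rewrite e0 eqxx in jn.
Qed.

Lemma ext_edges_pair i e : e \in S i -> e \subset L i /\ #|e| = 2.
Proof.
move=> eS; suff : e \in pairs (L i) by rewrite inE => /andP[? /eqP].
rewrite pairs_cone //; move: eS; rewrite /S !in_setU =>
  /orP[/(subsetP (FV i)) ->//|].
by case/imsetP => x /(subsetP (WV i)) xV ->; apply/orP; right; apply: imset_f.
Qed.

Lemma hinge_notin_ext i j : h j \notin S i.
Proof.
rewrite in_setU negb_or hF; apply: (@notin_star _ _ _ _ (V j)); first exact: vV.
by rewrite inE hinge_sub h2.
Qed.

Lemma ext_edges_disj i j : i != j -> S i :&: S j = set0.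
Proof.
move=> ij; apply/setP => e; rewrite [RHS]inE; apply/negbTE/negP => /setIP[].
move=> eS /ext_edges_pair[ej _]; have [ei e2] := ext_edges_pair eS.
by have [k ek] := shared_pair_is_hinge ij ei ej e2;
  move: (hinge_notin_ext i k); rewrite -ek eS.
Qed.

(** Extended links are induced subgraphs: an edge of another link with both ends here would be a
    hinge, and hinges are not edges of [E']. *)
Lemma ext_ring_local i e : e \in E' -> e \subset L i -> e \in S i.
Proof.
case/bigcupP => j _ eS ei; case: (eqVneq i j) => [->//|ij].
have [ej e2] := ext_edges_pair eS.
by have [k ek] := shared_pair_is_hinge ij ei ej e2;
  move: (hinge_notin_ext j k); rewrite -ek eS.
Qed.

Lemma card_corners i : #|W i| = 4.
Proof. by rewrite cardsU h_disj cards0 !h2. Qed.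

Lemma card_ext_edges i : #|S i| = #|F i| + 4.
Proof.
by rewrite cardsU (star_disjoint _ (vV i i) (FV i)) cards0 subn0 card_star card_corners.
Qed.

(** Start from the link edges with both hinges, which are independent inside the ring. The
    Henneberg-II extension that deletes the other hinge [k'] leaves exactly [h k |: S i]. *)
Lemma ext_edges_hinge_indep i k : k = i \/ k = ordS i ->
  erank p (h k |: S i) = #|h k |: S i|.
Proof.
move=> ik; pose k' := if k == i then ordS i else i.
have [WE kk' hk' hhs] : [/\ W i = h k' :|: h k, h k != h k',
    h k' :&: h k = set0 & [/\ h k \in pairs (V i) & h k' \in pairs (V i)]].
  rewrite /k' !inE !h2 eqxx !andbT; case: ik => ->.
    by rewrite eqxx setUC setIC next_hinge_neq h_disj hinge_sub next_hinge_sub.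
  by rewrite (negPf (ordS_neq i m_gt2)) eq_sym next_hinge_neq h_disj hinge_sub next_hinge_sub.
case: hhs => hk hk'V.
have /eqP/cards2P[a [b [ab kab]]] := h2 k'.
have /eqP/cards2P[c [d [cd kcd]]] := h2 k.
pose E0 := h k |: (h k' |: F i).
have E0V : E0 \subset pairs (V i) by rewrite !subUset !sub1set hk hk'V FV.
have E0i : erank p E0 = #|E0|.
  apply: (erank_indepS _ ring_indep);
    rewrite !subUset !sub1set !in_setU !imset_f //=.
  by apply: subset_trans (subsetUr _ _); apply: (bigcup_sup i).
have WE' : W i = [set a; b; c; d] by rewrite WE kab kcd -!setUA.
have u4 : uniq [:: a; b; c; d].
  have := card_corners i; rewrite WE' => c4; apply/card_uniqP; rewrite /= -c4.
  by apply: eq_card => x; rewrite !inE -!orbA.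
have vW : v i \notin [:: a; b; c; d].
  apply: contra (vV i i) => vW; apply: (subsetP (WV i)); rewrite WE'.
  by move: vW; rewrite !inE -!orbA.
have abE : [set a; b] \in E0 by rewrite -kab !inE eqxx orbT.
have := henneberg_erank gp E0V (vV i i) vW u4 abE E0i.
rewrite /= -WE' -kab; apply: erank_indepS.
rewrite subUset sub1set !inE eqxx kk' /= setSU //.
apply/subsetP => e eF; rewrite !inE eF !orbT andbT.
by apply: contraNneq (hF i k') => <-.
Qed.

Hypothesis F_rank : forall i, complete_rank #|V i| <= #|F i| + 2.

(** As [h i] is not in [E'], this bound makes [h i |: E'] dependent. It is proved with all hinges
    added at once. *)
Lemma ring_hinges_implied i : erank p (h i |: E') <= #|E'|.
Proof.
have cE' : #|E'| = \sum_i #|S i|.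
  rewrite -sum1_card partition_disjoint_bigcup /=.
    by apply: eq_bigr => j _; rewrite sum1_card.
  by move=> j k jk; rewrite -setI_eq0 ext_edges_disj.
(* The term [m] pays for the hinges. A link then adds [complete_rank #|V j| + 3] for its complete
   graph with the new vertex, minus 2 for its two hinges already counted. *)
have step (r : seq 'I_m) :
    erank p (hs :|: \bigcup_(i <- r) S i)
      <= m + \sum_(i <- r) (complete_rank #|V i| + 1).
  elim: r => [|j r IH].
    rewrite !big_nil setU0 addn0; apply: leq_trans (erank_card _ _) _.
    by apply: leq_trans (leq_imset_card _ _) _; rewrite cardT size_enum_ord.
  rewrite !big_cons; set T := hs :|: \bigcup_(i <- r) S i in IH *.
  have SLj : S j \subset pairs (L j).
    by apply/subsetP => e /ext_edges_pair[ej e2]; rewrite inE ej e2.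
  (* These two independent hinges are the overlap subtracted by submodularity. *)
  have hL2 : [set h j; h (ordS j)] \subset T :&: pairs (L j).
    have LV : V j \subset L j by apply: subsetUr.
    rewrite subUset !sub1set !inE !h2 eqxx !imset_f //=.
    by rewrite !(subset_trans _ LV) // ?next_hinge_sub ?hinge_sub.
  have h22 : erank p [set h j; h (ordS j)] = 2.
    rewrite (erank_indepS _ ring_indep) ?cards2 ?next_hinge_neq //.
    by rewrite subUset !sub1set !in_setU !imset_f.
  have := erank_modular p T (pairs (L j)).
  have := erankS p hL2; rewrite h22.
  have : erank p (hs :|: (S j :|: \bigcup_(i <- r) S i)) <=
    erank p (T :|: pairs (L j)).
    by apply: erankS; rewrite setUCA setUC setUS.
  have := erank_cone gp (vV j j); rewrite -/(L j) (erank_pairs (V j)) //.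
  have -> : 3 <= #|V j| by apply: leq_trans (subset_leq_card (WV j));
    rewrite card_corners.
  by move=> /(_ isT) ->; move: IH; lia.
have sub : h i |: E' \subset hs :|: \bigcup_(i <- enum 'I_m) S i.
  by rewrite subUset sub1set in_setU imset_f //= big_enum subsetUr.
apply: leq_trans (erankS p sub) _; apply: leq_trans (step _) _;
  rewrite cE' big_enum /=.
(* Spreading [m] as one unit per link leaves [complete_rank #|V j| + 2 <= #|F j| + 4], which is
   [F_rank]. *)
rewrite -[m in m + _](card_ord m) -sum1_card -big_split /=.
apply: leq_sum => j _; rewrite card_ext_edges; have := F_rank j; lia.
Qed.

Hypothesis E'_indep : erank p E' = #|E'|.
Hypothesis F_nf : forall i (X : {set U}) (E : {set {set U}}), X \subset V i ->
  E \subset F i -> E \subset pairs X -> 5 <= #|X| ->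
  erank p E <> complete_rank #|X|.

(** * Excluding rigid subgraphs of the extended ring *)

Section Nucleation.
Variables (X : {set U}) (E : {set {set U}}).
Hypotheses (EE' : E \subset E') (EX : E \subset pairs X) (X5 : 5 <= #|X|)
  (XL : X \subset \bigcup_i L i) (E_rigid : erank p E = complete_rank #|X|).

Lemma E_card : #|E| = complete_rank #|X|.
Proof. by rewrite -E_rigid (erank_indepS EE'). Qed.

(** The hinge is missing from [D] but independent together with it, so the complete graph on [Y] has
    room for one more independent edge. *)
Lemma full_hinge_card i k (Y : {set U}) (D : {set {set U}}) :
  k = i \/ k = ordS i -> D \subset S i -> D \subset pairs Y -> h k \subset Y ->
  #|D| < complete_rank #|Y|.
Proof.
move=> ik DS DY hY; have hD : h k \notin D
  by apply: contra (hinge_notin_ext i k); apply: subsetP.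
rewrite -add1n -(erank_pairs Y gp U4).
have -> : 1 + #|D| = #|h k |: D| by rewrite cardsU1 hD.
rewrite -(erank_indepS _ (ext_edges_hinge_indep ik)); last exact: setUS.
by apply: erankS; rewrite subUset DY andbT sub1set inE hY h2.
Qed.

Lemma not_in_link i : ~ X \subset L i.
Proof.
move=> Xi.
have ES : E \subset S i.
  apply/subsetP => e eE; apply: ext_ring_local; first exact: (subsetP EE').
  by have := subsetP EX e eE; rewrite inE => /andP[/subset_trans-> //].
have nh k : k = i \/ k = ordS i -> #|X :&: h k| <= 1.
  move=> ik; rewrite -ltnS -(h2 k) proper_card // properEneq subsetIr andbT.
  apply/eqP => /setIidPr hX; have := full_hinge_card ik ES EX hX.
  by rewrite E_card ltnn.
have [vX|vX] := boolP (v i \in X); last first.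
  apply: (F_nf (i := i) (X := X) (E := E)) => //.
    apply/subsetP => x xX; have := subsetP Xi x xX; rewrite !inE =>
      /orP[/eqP xv|//].
    by rewrite -xv xX in vX.
  apply/subsetP => e eE; have := subsetP ES e eE; rewrite in_setU => /orP[//|].
  case/imsetP => w _ ew; have := subsetP EX e eE; rewrite ew pair_in.
  by rewrite (negPf vX) andbF.
pose T := X :&: W i; pose Y := X :\ v i.
have XY : #|X| = #|Y|.+1 by rewrite (cardsD1 (v i)) vX.
have T2 : #|T| <= 2.
  rewrite /T /W setIUr; apply: leq_trans (leq_card_setU _ _) _.
  by rewrite (leq_add (n1 := 1) (n2 := 1)) // nh; [|left| |right].
have EYT : E \subset pairs Y :|: star (v i) T.
  apply/subsetP => e eE; have eX := subsetP EX e eE.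
  have := subsetP ES e eE; rewrite !in_setU => /orP[eF|/imsetP[w wW ew]].
    have := subsetP (FV i) e eF; move: eX; rewrite !inE =>
      /andP[eX ->] /andP[/subsetP eV _].
    rewrite subsetD1 eX /=; apply/orP; left; rewrite andbT.
    by apply: contra (vV i i); apply: eV.
  apply/orP; right; rewrite ew; apply: imset_f; rewrite inE wW andbT.
  by move: eX; rewrite ew pair_in => /and3P[].
(* With [n] vertices in [X], the rank is at most [3 * (n - 1) - 6 + 2], one less than rigidity
   requires. *)
have := leq_trans (erankS p EYT) (erankU_card _ _ _).
by rewrite E_rigid card_star erank_pairs // XY /complete_rank; lia.
Qed.

Lemma hinge_missed : exists j, X :&: h j = set0.
Proof.
have [/existsP[j /eqP]|/existsPn hX] := boolP [exists j, X :&: h j == set0].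
  by exists j.
exfalso.
pose s j := #|X :&: h j|; pose Xi i := X :&: L i; pose Ei i := E :&: S i.
have s1 j : 0 < s j by rewrite lt0n cards_eq0.
have s2 j : s j <= 2 by rewrite -(h2 j) subset_leq_card // subsetIr.
have EiX i : Ei i \subset pairs (Xi i).
  apply/subsetP => e /setIP[/(subsetP EX) eX /ext_edges_pair[ei e2]].
  by move: eX; rewrite !inE subsetI ei => /andP[-> ->].
have full i k : k = i \/ k = ordS i -> s k = 2 -> #|Ei i| < complete_rank #|Xi i|.
  move=> ik sk; apply: (full_hinge_card ik) => //; first exact: subsetIr.
  rewrite subsetI; apply/andP; split.
    by apply/setIidPr/eqP; rewrite eqEcard subsetIr h2 -sk leqnn.
  apply: subset_trans (subsetUr _ _).
  by case: ik => ->; [exact: hinge_sub|exact: next_hinge_sub].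
have Ei_le i : #|Ei i| <= complete_rank #|Xi i|.
  by rewrite -(erank_pairs _ gp U4) -(erank_indepS _ E'_indep) ?erankS //
    (subset_trans (subsetIl _ _)).
have Xi_ge i : s i + s (ordS i) <= #|Xi i|.
  have <- : #|(X :&: h i) :|: (X :&: h (ordS i))| = s i + s (ordS i).
    by rewrite cardsU setIACA setIid h_disj setI0 cards0 subn0.
  rewrite -setIUr; apply/subset_leq_card/setIS.
  by apply: subset_trans (WV i) (subsetUr _ _).
(* Equality is possible only when both hinges lie in [X]; then [full] gives
   [#|Ei i| <= 3 * #|Xi i| - 7]. With fewer hinge vertices there is slack. *)
have loc i : 2 * #|Ei i| + 2 + 3 * (s i + s (ordS i)) <= 6 * #|Xi i|.
  have := full i i (or_introl erefl); have := full i (ordS i) (or_intror erefl).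
  have := Ei_le i; have := Xi_ge i; have := s1 i; have := s1 (ordS i).
  have := s2 i; have := s2 (ordS i); rewrite /complete_rank.
  move: #|Ei i| #|Xi i| (s i) (s (ordS i)) => a b c d *.
  lia.
have sumX : \sum_i #|Xi i| = #|X| + \sum_j s j.
  have EI (A : 'I_m -> {set U}) :
      \sum_i #|X :&: A i| = \sum_(x in X) \sum_i (x \in A i : nat).
    rewrite exchange_big /=; apply: eq_bigr => i _.
    rewrite -sum1_card big_mkcond [RHS]big_mkcond /=; apply: eq_bigr => x _.
    by rewrite inE; case: (x \in X); case: (x \in A i).
  rewrite !EI -sum1_card -big_split /=; apply: eq_bigr => x xX.
  by apply: ext_verts_multiplicity; have /bigcupP[i _ xi] := subsetP XL x xX;
    exists i.
have sumE : #|E| <= \sum_i #|Ei i|.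
  have -> : E = \bigcup_i Ei i.
    by rewrite /Ei -big_distrr /=; apply/esym/setIidPl.
  apply: (big_ind2 (fun (A : {set {set U}}) n => #|A| <= n)) => [|A a B b Aa Bb|//].
    by rewrite cards0.
  by apply: leq_trans (leq_card_setU _ _) _; apply: leq_add.
have sumS : \sum_i s (ordS i) = \sum_i s i.
  by rewrite [RHS](reindex (@ordS m)) //; apply: onW_bij; apply: ordS_bij.
(* The hinge terms cancel in the sum, leaving [#|E| + m <= 3 * #|X|]. Since [#|E|] is
   [3 * #|X| - 6], this would force [m <= 6]. *)
have : \sum_i (2 * #|Ei i| + 2 + 3 * (s i + s (ordS i))) <= \sum_i (6 * #|Xi i|).
  by apply: leq_sum => i _; apply: loc.
rewrite !big_split /= !big1_eq sumS sumX sum_nat_const card_ord.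
by move: sumE m7 X5; rewrite E_card /complete_rank;
  move: (\sum_i s i) (\sum_i #|Ei i|) => a b; lia.
Qed.

Lemma in_link : exists i, X \subset L i.
Proof.
have [j Xj] := hinge_missed.
have nXj x : x \in X -> x \notin h j.
  by move=> xX; apply/negP => xj; have := in_set0 x; rewrite -Xj inE xX xj.
(* Positions along the chain obtained by opening the ring at the hinge j. *)
pose pos (i : 'I_m) := (i + (m - j)) %% m.
have jm := ltn_ord j.
have posE (i : 'I_m) : pos i = if j <= i then i - j else i + m - j.
  rewrite /pos; have im := ltn_ord i; case: leqP => ij.
    by rewrite (_ : i + (m - j) = i - j + m) ?modnDr ?modn_small //; lia.
  by rewrite modn_small; lia.
have pos_inj i k : pos i = pos k -> i = k.
  rewrite !posE => ik; apply: val_inj => /=; move: (ltn_ord i) (ltn_ord k) ik.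
  by case: (leqP j i) => ?; case: (leqP j k) => ?; lia.
have posS i : ordS i != j -> pos (ordS i) = (pos i).+1.
  move=> /eqP ij; have : (ordS i : nat) <> j by move/val_inj.
  rewrite !posE ordS_val; have := ltn_ord i.
  by case: eqP => e; case: (leqP j i) => ?; case: (leqP j _) => ?; lia.
have pos_lt i : pos i < m by rewrite ltn_pmod //; lia.
(* [A k] and [B k] are the parts of [X] in the first [k] links of the chain and in the remaining
   ones. *)
pose A k := X :&: \bigcup_(i | pos i < k) L i.
pose B k := X :&: \bigcup_(i | k <= pos i) L i.
have memA k x : reflect (x \in X /\ exists2 i, pos i < k & x \in L i) (x \in A k).
  rewrite inE; apply: (iffP andP) => -[xX]; first by case/bigcupP => i ik xi;
    split=> //; exists i.
  by case=> i ik xi; split=> //; apply/bigcupP; exists i.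
have memB k x : reflect (x \in X /\ exists2 i, k <= pos i & x \in L i) (x \in B k).
  rewrite inE; apply: (iffP andP) => -[xX]; first by case/bigcupP => i ik xi;
    split=> //; exists i.
  by case=> i ik xi; split=> //; apply/bigcupP; exists i.
(* Links sharing a vertex are cyclically consecutive, and [X] misses the hinge [j] that closes the
   cycle; a common vertex therefore lies on the one hinge between positions [k - 1] and [k]. *)
have AB k x : x \in A k -> x \in B k -> exists2 i, pos i = k & x \in h i.
  move=> /memA[xX [i ik xi]] /memB[_ [i' ik' xi']].
  have ii' : i != i' by apply: contraTneq ik => ->; rewrite -leqNgt.
  have [[iE xh]|[iE xh]] := ext_verts_meet ii' xi xi'.
    exists i' => //; have := posS i; rewrite -iE => /(_ _)/wrap[]; last by lia.
    by apply: contraTneq xh => ->; apply: nXj.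
  have := posS i'; rewrite -iE => /(_ _)/wrap[]; last by lia.
  by apply: contraTneq xh => ->; apply: nXj.
have ABX k : A k :|: B k = X.
  apply/setP => x; rewrite in_setU; apply/orP/idP => [[/memA[]|/memB[]] //|xX].
  have /bigcupP[i _ xi] := subsetP XL x xX.
  by case: (ltnP (pos i) k) => ik; [left; apply/memA|right; apply/memB];
    split=> //; exists i.
have AB2 k : #|A k :&: B k| <= 2.
  have [->|[x /setIP[xA xB]]] := set_0Vmem (A k :&: B k); first by rewrite cards0.
  have [i ik _] := AB k x xA xB; rewrite -(h2 i);
    apply/subset_leq_card/subsetP => y.
  by case/setIP => yA yB; have [i' ik' yi] := AB k y yA yB;
    rewrite (pos_inj i i') ?ik.
have cut k : X \subset A k \/ X \subset B k.
  have EAB : E \subset pairs (A k) :|: pairs (B k).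
    apply/subsetP => e eE;
      have /bigcupP[i _ /ext_edges_pair[/subsetP ei e2]] := subsetP EE' e eE.
    have := subsetP EX e eE; rewrite inE => /andP[/subsetP eX _].
    rewrite !inE e2 eqxx !andbT.
    case: (ltnP (pos i) k) => ik; apply/orP; [left|right]; apply/subsetP => x xe.
      by apply/memA; split; [exact: eX|exists i => //; exact: ei].
    by apply/memB; split; [exact: eX|exists i => //; exact: ei].
  have := rigid_cut gp U4 EAB (AB2 k); rewrite ABX E_rigid => /(_ (leqnn _)).
  by case=> sub; [right|left]; rewrite -{1}(ABX k) subUset sub subxx.
have exA : exists k, X \subset A k.
  exists m; rewrite -{1}(ABX m) subUset subxx; apply/subsetP => x /memB[_ [i]].
  by rewrite leqNgt pos_lt.
have [x0 x0X] : exists x, x \in X by apply/card_gt0P; lia.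
(* [A 0] is empty. If [k.+1] is least with [X] inside [A k.+1], then [cut k] puts [X] inside [B k]
   too, which pins [X] to the link at position [k]. *)
case: (ex_minnP exA) => -[|k] XA kmin.
  by have /memA[_ []] := subsetP XA x0 x0X.
have nXA : ~~ (X \subset A k) by apply/negP => /kmin; rewrite ltnn.
have XB : X \subset B k by case: (cut k) => // XA'; rewrite XA' in nXA.
have /subsetPn[x xX xA] := nXA.
have /memA[_ [i ik xi]] := subsetP XA x xX.
have pik : pos i = k.
  apply/eqP; rewrite eqn_leq -ltnS ik leqNgt; apply: contra xA => ik'.
  by apply/memA; split=> //; exists i.
exists i; apply/subsetP => y yX; have /memA[_ [i' ik' yi]] := subsetP XA y yX.
move: ik'; rewrite ltnS leq_eqVlt => /orP[/eqP ik'|ik'].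
  by rewrite (pos_inj i i') // pik.
(* A vertex found in an earlier link also lies in [B k], hence on the hinge at which the link at
   position [k] begins. *)
have yA : y \in A k by apply/memA; split=> //; exists i'.
have [i2 i2k yi2] := AB k y yA (subsetP XB y yX).
by apply: hinge_sub_ext; rewrite (pos_inj i i2) // pik.
Qed.

Lemma no_rigid_subgraph : False.
Proof. by have [i] := in_link; apply: not_in_link. Qed.

End Nucleation.

Lemma ring_nucleation_free (X : {set U}) (E : {set {set U}}) :
  E \subset E' -> E \subset pairs X -> 5 <= #|X| -> X \subset \bigcup_i L i ->
  erank p E <> complete_rank #|X|.
Proof. by move=> EE' EX X5 XL; apply: no_rigid_subgraph. Qed.

End RingOfLinks.

(** * Circuits, generic placements and independence of Henneberg-II extensions *)

Section Matroid.
Variables (R : realType) (U : finType).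
Implicit Types (p : U -> 'rV[R]_3) (C D E : {set {set U}}).

Lemma circuit_exists D : ~ R3_indep R D ->
  exists C, C \subset D /\ R3_circuit R C.
Proof.
move=> Dd; pose P C := `[< ~ R3_indep R C >].
have [C minC CD] := @minset_exists _ P D (introT (asboolP _) Dd).
exists C; split=> //; case/minsetP: minC => /asboolP Cd Cmin; split=> // F FC.
apply: contrapT => /asboolP PF; have FC' := Cmin F PF (proper_sub FC).
by rewrite FC' properxx in FC.
Qed.

(** Generic placements are not constructed: if there were none, no set would satisfy [R3_indep] and
    every rank would be 0. *)
Lemma generic_of_rank E : 0 < R3_rank R E -> exists p, generic p.
Proof.
move=> rE; apply: contrapT => ng; suff E0 : R3_rank R E = 0 by rewrite E0 in rE.
apply: big1 => F /andP[_ /asboolP[p gp _]]; by case: ng; exists p.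
Qed.

Lemma hennebergII_indep p (G G' : sgraph U) (W e : {set U}) v : generic p ->
  hennebergII G W e v G' -> erank p (edges G) = #|edges G| ->
  erank p (edges G') = #|edges G'|.
Proof.
move=> gp [[WG W4] [eG eW] vG _ EG'] Gi.
have /pairsP[a [b [ab aG bG eab]]] := subsetP (edges_pairs G) e eG.
have : #|W :\: e| = 2.
  by have := cardsID e W; rewrite (setIidPr eW) W4 eab cards2 ab; lia.
move/eqP/cards2P => [c [d [cd Wcd]]].
have WE : W = [set a; b; c; d].
  by rewrite -(setID W e) (setIidPr eW) Wcd eab -!setUA.
have u4 : uniq [:: a; b; c; d].
  apply/card_uniqP; rewrite /= -[RHS]W4 WE.
  by apply: eq_card => x; rewrite !inE -!orbA.
have vW : v \notin [:: a; b; c; d].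
  apply: contra vG => vW; apply: (subsetP WG); rewrite WE.
  by move: vW; rewrite !inE -!orbA.
rewrite EG' eab WE.
by apply: (henneberg_erank gp (edges_pairs G) vG vW u4 _ Gi); rewrite -eab.
Qed.

End Matroid.

(** * The glued ring *)

Section Glue.
Variables (U : finType) (m : nat) (G : 'I_m -> link U).
Hypotheses (m3 : 3 <= m) (disj : vertex_disjoint G).

Lemma link_eq i j x : x \in verts (G i) -> x \in verts (G j) -> i = j.
Proof.
move=> xi xj; apply/eqP; apply: contraTT xi => /disj /disjointFl -> //.
Qed.

Lemma hinge_mem i x : x \in [:: ha (G i); hb (G i); hc (G i); hd (G i)] ->
  x \in verts (G i).
Proof.
move=> xi; apply: (subsetP (hinge_verts (G i))); move: xi.
by rewrite !inE -!orbA.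
Qed.

Lemma ha_mem i : ha (G i) \in verts (G i).
Proof. by apply: hinge_mem; rewrite !inE eqxx. Qed.
Lemma hb_mem i : hb (G i) \in verts (G i).
Proof. by apply: hinge_mem; rewrite !inE eqxx ?orbT. Qed.
Lemma hc_mem i : hc (G i) \in verts (G i).
Proof. by apply: hinge_mem; rewrite !inE eqxx ?orbT. Qed.
Lemma hd_mem i : hd (G i) \in verts (G i).
Proof. by apply: hinge_mem; rewrite !inE eqxx ?orbT. Qed.

Lemma hinge_points_neq i : [/\ ha (G i) != hb (G i), ha (G i) != hc (G i),
  ha (G i) != hd (G i), hb (G i) != hc (G i) &
  hb (G i) != hd (G i) /\ hc (G i) != hd (G i)].
Proof.
have := hinge_uniq (G i); rewrite /= !inE !negb_or.
by case/and4P => /and3P[-> -> ->] /andP[-> ->] ->.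
Qed.

Lemma glue_c i : glue G (hc (G i)) = ha (G (ordS i)).
Proof.
rewrite /glue; case: pickP => [j /eqP e|/(_ i)]; last by rewrite eqxx.
by rewrite (@link_eq i j (hc (G i))) ?hc_mem // e hc_mem.
Qed.

Lemma glue_d i : glue G (hd (G i)) = hb (G (ordS i)).
Proof.
rewrite /glue; case: pickP => [j /eqP e|_].
  have ij : i = j by apply: (@link_eq i j (hd (G i))); rewrite ?hd_mem // e hc_mem.
  by have [_ _ _ _ [_]] := hinge_points_neq i; rewrite e -ij eqxx.
case: pickP => [j /eqP e|/(_ i)]; last by rewrite eqxx.
by rewrite (@link_eq i j (hd (G i))) ?hd_mem // e hd_mem.
Qed.

Lemma glue_id i x : x \in verts (G i) -> x != hc (G i) -> x != hd (G i) ->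
  glue G x = x.
Proof.
move=> xi xc xd; rewrite /glue; case: pickP => [j /eqP e|_].
  have ij : i = j by apply: (@link_eq i j x); rewrite // e hc_mem.
  by rewrite ij -e eqxx in xc.
case: pickP => [j /eqP e|//].
have ij : i = j by apply: (@link_eq i j x); rewrite // e hd_mem.
by rewrite ij -e eqxx in xd.
Qed.

Lemma glue_a i : glue G (ha (G i)) = ha (G i).
Proof. by have [_ ? ? _ _] := hinge_points_neq i; rewrite (@glue_id i) ?ha_mem. Qed.

Lemma glue_b i : glue G (hb (G i)) = hb (G i).
Proof. by have [_ _ _ ? [? _]] := hinge_points_neq i;
  rewrite (@glue_id i) ?hb_mem. Qed.

(** [glue] fixes [ha] and [hb] and sends [hc] and [hd] to those of the next link, so these two names
    represent the glued hinge. *)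
Definition ring_hinge (i : 'I_m) : {set U} := [set ha (G i); hb (G i)].

Definition ring_link (i : 'I_m) : {set U} := glue G @: verts (G i).

Definition link_edges (i : 'I_m) : {set {set U}} :=
  [set glue G @: (e : {set U}) | e in edges (G i) :\: hinges (G i)].

Lemma ring_hinge_verts i : ring_hinge i \subset verts (G i).
Proof. by rewrite subUset !sub1set ha_mem hb_mem. Qed.

Lemma glue_cases i x : x \in verts (G i) ->
  [\/ x = hc (G i), x = hd (G i) | glue G x = x].
Proof.
move=> xi; case: (eqVneq x (hc (G i))) => [|xc]; first by constructor 1.
case: (eqVneq x (hd (G i))) => [|xd]; first by constructor 2.
by constructor 3; apply: glue_id xc xd.
Qed.

(** [glue] moves only [hc] and [hd] of this link, and sends them to distinct vertices of the next
    link, which is disjoint from it. *)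
Lemma glue_inj i : {in verts (G i) &, injective (glue G)}.
Proof.
have sepa x : x \in verts (G i) -> x <> ha (G (ordS i)).
  move=> xi e; have := ordS_neq i m3.
  by rewrite (@link_eq (ordS i) i x) ?eqxx // e ha_mem.
have sepb x : x \in verts (G i) -> x <> hb (G (ordS i)).
  move=> xi e; have := ordS_neq i m3.
  by rewrite (@link_eq (ordS i) i x) ?eqxx // e hb_mem.
have [/eqP ab _ _ _ _] := hinge_points_neq (ordS i).
move=> x y xi yi; case: (glue_cases xi) => [->|->|->]; case: (glue_cases yi) =>
  [->|->|->];
  rewrite ?glue_c ?glue_d //.
- by move/esym/(sepa y yi).
- by move/esym.
- by move/esym/(sepb y yi).
- by move/(sepa x xi).
by move/(sepb x xi).
Qed.

Lemma ring_linkP i x : x \in ring_link i ->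
  x \in verts (G i) \/ x \in ring_hinge (ordS i).
Proof.
case/imsetP => y yi ->; case: (glue_cases yi) => [->|->|->]; last by left.
  by right; rewrite glue_c !inE eqxx.
by right; rewrite glue_d !inE eqxx orbT.
Qed.

Lemma ring_hinge_verticesE i :
  ring_hinge_vertices G i = ring_hinge i :|: ring_hinge (ordS i).
Proof.
rewrite /ring_hinge_vertices /hinge_vertices -setUA !imsetU !imset_set1.
by rewrite glue_a glue_b glue_c glue_d.
Qed.

Lemma glue_ab i : glue G @: [set ha (G i); hb (G i)] = ring_hinge i.
Proof. by rewrite imsetU1 imset_set1 glue_a glue_b. Qed.

Lemma glue_cd i : glue G @: [set hc (G i); hd (G i)] = ring_hinge (ordS i).
Proof. by rewrite imsetU1 imset_set1 glue_c glue_d. Qed.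

Lemma ring_hingesE i :
  ring_hinges G i = [set ring_hinge i; ring_hinge (ordS i)].
Proof. by rewrite /ring_hinges /hinges imsetU1 imset_set1 glue_ab glue_cd. Qed.

Lemma card_ring_hinge i : #|ring_hinge i| = 2.
Proof. by have [ab _ _ _ _] := hinge_points_neq i; rewrite cards2 ab. Qed.

Lemma ring_corners_sub i :
  ring_hinge i :|: ring_hinge (ordS i) \subset ring_link i.
Proof. by rewrite -ring_hinge_verticesE; apply/imsetS/hinge_verts. Qed.

Lemma ring_hinge_disj i : ring_hinge i :&: ring_hinge (ordS i) = set0.
Proof.
apply/setP => x; rewrite [RHS]inE; apply/negbTE/negP => /setIP[].
move=> /(subsetP (ring_hinge_verts _)) xi /(subsetP (ring_hinge_verts _)).
by move/(link_eq xi)/esym/eqP; rewrite (negPf (ordS_neq i m3)).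
Qed.

Lemma ring_link_meet i j x : i != j -> x \in ring_link i -> x \in ring_link j ->
  (j = ordS i /\ x \in ring_hinge j) \/ (i = ordS j /\ x \in ring_hinge i).
Proof.
move=> /eqP ij /ring_linkP[xi|xi] /ring_linkP[xj|xj].
- by case: ij; apply: link_eq xi xj.
- right; have e := link_eq xi (subsetP (ring_hinge_verts _) _ xj).
  by rewrite e.
- left; have e := link_eq xj (subsetP (ring_hinge_verts _) _ xi).
  by rewrite e.
case: ij; apply: ordS_inj.
exact: link_eq (subsetP (ring_hinge_verts _) _ xi) (subsetP (ring_hinge_verts _) _ xj).
Qed.

Lemma link_edges_pairs i : link_edges i \subset pairs (ring_link i).
Proof.
rewrite -(pairs_imset (@glue_inj i)); apply: imsetS.
exact: subset_trans (subsetDl _ _) (edges_pairs _).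
Qed.

(** A ring hinge inside link [i] is the image of a hinge of [G i]; injectivity of [glue] would make
    the edge mapped onto it that very hinge, which was removed. *)
Lemma hinge_notin_link i j : ring_hinge j \notin link_edges i.
Proof.
apply/negP => /imsetP[e /setDP[eG eh] je].
have eV := subsetP (edges_pairs _) e eG.
have aj : ha (G j) \in ring_link i.
  apply: (subsetP _ _ (set21 (ha (G j)) (hb (G j)))); rewrite -/(ring_hinge j) je.
  by apply: imsetS; move: eV; rewrite inE => /andP[].
have contra_e f : f \in hinges (G i) -> f \in pairs (verts (G i)) ->
    glue G @: e = glue G @: f -> False.
  move=> fh fV ef; have ef' := imset_set_inj (@glue_inj i) eV fV ef.
  by rewrite ef' fh in eh.
have [n1 _ _ _ [_ n2]] := hinge_points_neq i.
case: (ring_linkP aj) =>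
  [/(link_eq (ha_mem j)) ji|/(subsetP (ring_hinge_verts _))/(link_eq (ha_mem j)) ji].
  apply: (contra_e [set ha (G i); hb (G i)]); first exact: set21.
    by rewrite pair_in n1 ha_mem hb_mem.
  by rewrite glue_ab -ji je.
apply: (contra_e [set hc (G i); hd (G i)]); first exact: set22.
  by rewrite pair_in n2 hc_mem hd_mem.
by rewrite glue_cd -ji je.
Qed.

Lemma ring_vertsE : verts (ring_graph G) = \bigcup_i ring_link i.
Proof.
rewrite /= /ring_link; apply/setP => x; apply/imsetP/bigcupP.
  by case=> y /bigcupP[i _ yi] ->; exists i => //; apply: imset_f.
by case=> i _ /imsetP[y yi ->]; exists y => //; apply/bigcupP; exists i.
Qed.

Lemma ring_edgesE :
  (forall i, ring_hinges G i \subset edges (ring_graph G)) ->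
  edges (ring_graph G) = hinge_set ring_hinge :|: \bigcup_i link_edges i.
Proof.
move=> hh; apply/eqP; rewrite eqEsubset; apply/andP; split.
  apply/subsetP => e /setIP[/imsetP[f /bigcupP[i _ fi] ->] _]; apply/setUP.
  case: (boolP (f \in hinges (G i))) => fh.
    left; rewrite !inE in fh; case/orP: fh => /eqP ->.
      by rewrite glue_ab; apply: imset_f.
    by rewrite glue_cd; apply: imset_f.
  by right; apply/bigcupP; exists i => //; apply: imset_f; rewrite inE fh.
rewrite subUset; apply/andP; split.
  apply/subsetP => _ /imsetP[i _ ->]; apply: (subsetP (hh i)).
  by rewrite ring_hingesE !inE eqxx.
apply/bigcupsP => i _; apply/subsetP => e eF; apply/setIP; split.
  case/imsetP: eF => f /setDP[fi _] ->; apply: imset_f; apply/bigcupP.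
  by exists i.
have := subsetP (link_edges_pairs i) e eF; apply/subsetP/pairsS/imsetS.
exact: bigcup_sup.
Qed.

End Glue.

(** * The vertices and edges left after all Henneberg-II extensions *)

Section Extension.
Variables (U : finType) (m : nat) (G : 'I_m -> link U).
Hypotheses (m3 : 3 <= m) (disj : vertex_disjoint G).
Hypothesis hh : forall i, ring_hinges G i \subset edges (ring_graph G).

(** Each deleted edge must still be present at its stage, so the deletions are distinct; [m] of them
    among at most [m] hinges remove every hinge, whatever choices were made. *)
Lemma henneberg_ring_shape R' : henneberg_ring G R' ->
  exists v : 'I_m -> U,
  [/\ injective v, forall i, v i \notin verts (ring_graph G),
      verts R' = verts (ring_graph G) :|: [set v i | i : 'I_m] &
      edges R' = \bigcup_i ext_edges (ring_hinge G) (link_edges G) v i].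
Proof.
case=> H [H0 Hm HS].
have [e /choice[v Hev]] := choice HS.
pose T (i : 'I_m) := star (v i) (ring_hinge_vertices G i).
pose St k := \bigcup_(i < m | i < k) T i.
pose Es k := [set e i | i : 'I_m & i < k].
have vertsH k : k <= m ->
    verts (H k) = verts (ring_graph G) :|: [set v i | i : 'I_m & i < k].
  elim: k => [_|k IH km].
    rewrite H0 [X in _ :|: X](_ : _ = set0) ?setU0 //.
    by apply/setP => x; rewrite inE; apply/negbTE/imsetP => -[i]; rewrite inE.
  pose i := Ordinal km; have [_ [_ _ _ /= -> _]] := Hev i.
  rewrite IH ?(ltnW km) // setUCA; congr (_ :|: _); apply/setP => x.
  rewrite in_setU1; apply/orP/imsetP => [[/eqP ->|/imsetP[j]]|[j]].
  - by exists i; rewrite ?inE.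
  - by rewrite inE => jk ->; exists j; rewrite // inE ltnS ltnW.
  rewrite inE ltnS leq_eqVlt => /orP[/eqP jk ->|jk ->]; [left|right].
    by apply/eqP; congr v; apply: val_inj.
  by apply: imset_f; rewrite inE.
have vH i : v i \notin verts (H i) by have [_ []] := Hev i.
have vring i : v i \notin verts (ring_graph G).
  by apply: contra (vH i); rewrite vertsH ?(ltnW (ltn_ord i)) // inE => ->.
have vlt (i j : 'I_m) : i < j -> v i != v j.
  move=> ij; apply: contra (vH j) => /eqP <-.
  by rewrite vertsH ?(ltnW (ltn_ord j)) // inE imset_f ?orbT // inE.
have vinj : injective v.
  move=> i j vij; apply: val_inj; case: (ltngtP i j) => // /vlt.
    by rewrite vij eqxx.
  by rewrite vij eqxx.
have ering i : e i \in hinge_set (ring_hinge G).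
  have [+ _] := Hev i; rewrite ring_hingesE // !inE.
  by case/orP => /eqP ->; apply: imset_f.
(* Deleted edges join ring vertices while star edges contain a new vertex, so no deletion touches a
   star. *)
have eT i j : e i \notin T j.
  have /imsetP[k _ ->] := ering i.
  rewrite /T; apply: notin_star (vring j) _;
    apply: (subsetP (edges_pairs (ring_graph G))).
  by apply: (subsetP (hh k)); rewrite ring_hingesE // !inE eqxx.
have eSt i k : e i \notin St k by apply/bigcupP => -[j _]; apply/negP/eT.
have edgesH k : k <= m -> edges (H k) = (edges (ring_graph G) :\: Es k) :|: St k.
  elim: k => [_|k IH km].
    rewrite H0 /St big_pred0_eq setU0 [Es 0](_ : _ = set0) ?setD0 //.
    by apply/setP => x; rewrite inE; apply/negbTE/imsetP => -[i]; rewrite inE.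
  pose i := Ordinal km; have [_ [_ _ _ _ /= ->]] := Hev i.
  have StE : St k :\ e i = St k by apply/setDidPl; rewrite disjoint_sym disjoints1.
  rewrite IH ?(ltnW km) // setDUl setDDl StE.
  have -> : Es k :|: [set e i] = Es k.+1.
    apply/setP => x; rewrite in_setU in_set1; apply/orP/imsetP =>
      [[/imsetP[j]|/eqP ->]|[j]].
    - by rewrite inE => jk ->; exists j; rewrite // inE ltnS ltnW.
    - by exists i; rewrite ?inE.
    rewrite inE ltnS leq_eqVlt => /orP[/eqP jk ->|jk ->]; [right|left].
      by apply/eqP; congr e; apply: val_inj.
    by apply: imset_f; rewrite inE.
  rewrite -setUA; congr (_ :|: _); rewrite /St [RHS](bigD1 i) //= setUC.
  congr (_ :|: _); apply: eq_bigl => j; rewrite ltnS -val_eqE /=.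
  by rewrite andbC ltn_neqAle.
have elt (i j : 'I_m) : i < j -> e i != e j.
  move=> ij; have [_ [_ [ej _] _ _ _]] := Hev j.
  move: ej; rewrite edgesH ?(ltnW (ltn_ord j)) // in_setU (negPf (eSt _ _)) orbF.
  by case/setDP => _; apply: contra => /eqP <-; apply: imset_f; rewrite inE.
have einj : injective e.
  move=> i j eij; apply: val_inj; case: (ltngtP i j) => // /elt.
    by rewrite eij eqxx.
  by rewrite eij eqxx.
have allI (T' : finType) (f : 'I_m -> T') :
    [set f i | i : 'I_m & i < m] = [set f i | i : 'I_m].
  by apply/setP => x; apply/imsetP/imsetP => -[i _ ->]; exists i; rewrite ?inE.
have EsE : Es m = hinge_set (ring_hinge G).
  rewrite /Es allI; apply/eqP; rewrite eqEcard; apply/andP; split.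
    by apply/subsetP => _ /imsetP[i _ ->].
  by rewrite (card_imset _ einj) (leq_trans (leq_imset_card _ _)).
exists v; split=> //; rewrite -Hm.
  by rewrite vertsH // allI.
rewrite edgesH // EsE ring_edgesE // setDUl setDv set0U.
rewrite (setDidPl _) /St; last first.
  rewrite disjoint_sym -setI_eq0; apply/eqP/setP => x; rewrite [RHS]inE.
  apply/negbTE/negP => /setIP[/imsetP[j _ ->] /bigcupP[i _]].
  by apply/negP/hinge_notin_link.
rewrite [X in _ :|: X](eq_bigl xpredT) => [|i]; last by rewrite ltn_ord.
rewrite -big_split /=; apply: eq_bigr => i _.
by rewrite /T ring_hinge_verticesE.
Qed.

End Extension.

(** * Carrying the hypotheses on the links over to the glued ring *)

Section LinkTransfer.
Variables (R : realType) (U : finType) (m : nat) (G : 'I_m -> link U).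
Variable p : U -> 'rV[R]_3.
Hypotheses (m3 : 3 <= m) (disj : vertex_disjoint G) (gp : generic p)
  (U4 : 4 <= #|U|).

Lemma ring_link_card i : #|ring_link G i| = #|verts (G i)|.
Proof. by rewrite card_in_imset //; apply: glue_inj. Qed.

(** A rigid link has at least as many edges as its rank, and at most two of them are hinges. *)
Lemma link_edges_rank i : rigid R (G i) ->
  complete_rank #|ring_link G i| <= #|link_edges G i| + 2.
Proof.
rewrite /rigid !(R3_rankE _ gp) ring_link_card (erank_pairs _ gp U4) => <-.
apply: leq_trans (erank_card _ _) _.
have -> : #|link_edges G i| = #|edges (G i) :\: hinges (G i)|.
  apply: card_in_imset => e f /setDP[eG _] /setDP[fG _].
  by apply: (imset_set_inj (@glue_inj _ _ _ m3 disj i));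
    apply: (subsetP (edges_pairs _)).
rewrite -(cardsID (hinges (G i)) (edges (G i))) addnC leq_add2l.
apply: leq_trans (subset_leq_card (subsetIr _ _)) _.
by rewrite cards2; case: eqP.
Qed.

(** Pull [X] and [E] back along [glue], which is injective on the link and so preserves rank; the
    result would be a nucleation of the link without its hinges. *)
Lemma link_edges_nf i (X : {set U}) (E : {set {set U}}) :
  nucleation_free R (del_edges (G i) (hinges (G i))) ->
  X \subset ring_link G i -> E \subset link_edges G i -> E \subset pairs X ->
  5 <= #|X| -> erank p E <> complete_rank #|X|.
Proof.
move=> nf XV EF EX X5 Er.
have gI := @glue_inj _ _ _ m3 disj i.
pose X0 := [set x in verts (G i) | glue G x \in X].
pose E0 := [set e in edges (G i) :\: hinges (G i) | glue G @: (e : {set U}) \in E].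
have E0X0 : E0 \subset pairs X0.
  apply/subsetP => e; rewrite inE => /andP[/setDP[eG _] eE].
  have := subsetP (edges_pairs _) e eG; have := subsetP EX _ eE.
  rewrite !inE => /andP[geX _] /andP[/subsetP eV ->]; rewrite andbT.
  apply/subsetP => x xe; rewrite inE eV //=.
  by apply: (subsetP geX); apply: imset_f.
have X0V : X0 \subset verts (G i) by apply/subsetP => x; rewrite inE => /andP[].
have XE : glue G @: X0 = X.
  apply/setP => x; apply/imsetP/idP => [[y]|xX]; first by rewrite inE =>
    /andP[_ yX ->].
  have /imsetP[y yV xy] := subsetP XV x xX.
  by exists y; rewrite // inE yV -xy.
have EE : [set glue G @: (e : {set U}) | e in E0] = E.
  apply/setP => e; apply/imsetP/idP => [[f]|eE]; first by rewrite inE =>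
    /andP[_ fE ->].
  have /imsetP[f fG ef] := subsetP EF e eE.
  by exists f; rewrite // inE fG -ef.
have cX : #|X| = #|X0|.
  by rewrite -XE card_in_imset //; apply: sub_in2 gI; apply: (subsetP X0V).
apply: (nf (SGraph E0X0)); split=> /=; rewrite -?cX //.
  split=> //=; apply/subsetP => e; rewrite inE => /andP[//].
rewrite /rigid /= !(R3_rankE _ gp) (erank_pairs _ gp U4) -cX -Er -EE.
by rewrite (erank_relabel gp gI) // (subset_trans E0X0) // pairsS.
Qed.

End LinkTransfer.

Theorem theorem3 (R : realType) (U : finType) (m : nat) (G : 'I_m -> link U)
    (R' : sgraph U)
    (hm : (7 <= m)%N)
    (hdisj : vertex_disjoint G)
    (hhinges : forall i : 'I_m, ring_hinges G i \subset edges (ring_graph G))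
    (hR' : henneberg_ring G R')
    (hindep : independent R (ring_graph G))
    (hrigid : forall i : 'I_m, rigid R (G i))
    (hnf : forall i : 'I_m,
        nucleation_free R (del_edges (G i) (hinges (G i)))) :
  [/\ independent R R',
      nucleation_free R R'
    & forall (i : 'I_m) (h : {set U}), h \in ring_hinges G i -> implied R R' h].
Proof.
have m3 : 3 <= m by lia.
have m0 : 0 < m by lia.
pose i0 := Ordinal m0.
have hinge_edge i : ring_hinge G i \in edges (ring_graph G).
  by apply: (subsetP (hhinges i)); rewrite ring_hingesE // set21.
(* The ring has a hinge edge and is independent, so its rank is positive. *)
have [p gp] : exists p : U -> 'rV[R]_3, generic p.
  apply: (@generic_of_rank _ _ (edges (ring_graph G))); rewrite hindep.
  by apply/card_gt0P; exists (ring_hinge G i0).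
have U4 : 4 <= #|U|.
  by rewrite -[4](card_uniqP (hinge_uniq (G i0))) max_card.
have ring_indep : erank p (edges (ring_graph G)) = #|edges (ring_graph G)|.
  by rewrite -(R3_rankE _ gp).
have R'_indep : erank p (edges R') = #|edges R'|.
  case: hR' => H [H0 <- HS].
  have : forall k, k <= m -> erank p (edges (H k)) = #|edges (H k)|.
    elim=> [_|k IH km]; first by rewrite H0.
    have [e [v [_ HII]]] := HS (Ordinal km).
    exact: hennebergII_indep gp HII (IH (ltnW km)).
  exact.
have [v [v_inj vring vertsR' edgesR']] := henneberg_ring_shape m3 hdisj hhinges hR'.
have vV i j : v i \notin ring_link G j.
  apply: contra (vring i); rewrite ring_vertsE; apply/subsetP.
  exact: bigcup_sup.
have extL i : ring_link G i \subset verts R'.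
  by rewrite vertsR' ring_vertsE (subset_trans _ (subsetUl _ _)) // bigcup_sup.
have hnotin i j : ring_hinge G j \notin link_edges G i by apply: hinge_notin_link.
rewrite ring_edgesE // in ring_indep.
have hcard i : #|ring_hinge G i| = 2 by apply: card_ring_hinge.
split.
- by rewrite /independent (R3_rankE _ gp).
- move=> N [[NV NE] Nr N5]; move: Nr;
  rewrite /rigid !(R3_rankE _ gp) (erank_pairs _ gp U4).
  move: NE R'_indep; rewrite edgesR' => NE R'_indep Nr.
  have NX : verts N \subset \bigcup_i ext_verts (ring_link G) v i.
    apply: subset_trans NV _; rewrite vertsR' ring_vertsE subUset; apply/andP;
      split.
      apply/bigcupsP => i _; apply: (subset_trans (subsetUr [set v i] _)).
      exact: (bigcup_sup i).
    apply/subsetP => _ /imsetP[i _ ->]; apply/bigcupP; exists i => //.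
    exact: setU11.
  have Fnf i X E := @link_edges_nf R U m G p m3 hdisj gp U4 i X E (hnf i).
  exact: (ring_nucleation_free hm gp U4 hcard (ring_corners_sub hdisj)
    (ring_hinge_disj m3 hdisj) (ring_link_meet hdisj) (link_edges_pairs m3 hdisj)
    hnotin vV v_inj ring_indep R'_indep Fnf NE (edges_pairs N) N5 NX Nr).
move=> i h hi.
have [k ->] : exists k, h = ring_hinge G k.
  by move: hi; rewrite ring_hingesE // !inE => /orP[] /eqP ->;
    [exists i|exists (ordS i)].
have le : erank p (ring_hinge G k |: edges R') <= #|edges R'|.
  rewrite edgesR'.
  have Frank j := link_edges_rank m3 hdisj gp U4 (hrigid j).
  exact: (ring_hinges_implied hm gp U4 hcard (ring_corners_sub hdisj)
    (ring_hinge_disj m3 hdisj) (ring_link_meet hdisj) (link_edges_pairs m3 hdisj)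
    hnotin vV v_inj ring_indep Frank).
have hE : ring_hinge G k \notin edges R'.
  rewrite edgesR'; apply/bigcupP => -[j _]; apply/negP.
  exact: (hinge_notin_ext hcard (ring_corners_sub hdisj) hnotin vV).
split.
  rewrite in_setD hE; apply: (subsetP (pairsS (extL k))).
  rewrite inE card_ring_hinge // eqxx andbT.
  exact: subset_trans (subsetUl _ _) (ring_corners_sub hdisj k).
(* The circuit found in this dependent set must use the hinge, because the edges of [R'] alone are
   independent. *)
have [|C [CE circC]] := @circuit_exists R U (ring_hinge G k |: edges R').
  by move/(R3_indepP _ gp); rewrite cardsU1 hE => e; rewrite e ltnn in le.
exists C; split=> //; apply: contraT => hC; case: circC => + _; case.
apply/(R3_indepP _ gp)/(erank_indepS _ R'_indep)/subsetP => e eC.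
have := subsetP CE e eC; rewrite in_setU1 => /orP[/eqP eh|//].
by rewrite -eh eC in hC.
Qed.
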